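(* Let $\mathfrak{TD}$ be a transition diagram for a zigzag filtration of block decompositions on a finite $T_0$ space $X$, and let $\mathbb M$ be its Conley–Morse persistence module (over a fixed field $k$). Let $(Q,I)$ be the bound quiver in which $Q$ is the Hasse diagram of the partial order induced by $\mathfrak{TD}$ and $I$ is the ideal of $kQ$ generated by all two-arrow paths coming from AR-splits in $\mathfrak{TD}$. Then $\mathbb M$, viewed as a representation of $(Q,I)$, decomposes uniquely, up to isomorphism, into a direct sum of string modules of $(Q,I)$.
   Context: Multivector fields. $X$ is a finite $T_0$ topological space; $\operatorname{mo}A=\operatorname{cl}A\setminus A$; $A$ is locally closed if $\operatorname{mo}A$ is closed. Homology has coefficients in a fixed field $k$. A multivector field $\mathcal V$ on $X$ is a partition of $X$ into locally closed sets (multivectors); $[x]_{\mathcal V}$ is the multivector containing $x$; a multivector $V$ is regular if $H(\operatorname{cl}V,\operatorname{mo}V)=0$, otherwise critical. $F_{\mathcal V}(x)=\operatorname{cl}\{x\}\cup[x]_{\mathcal V}$ and $F_{\mathcal V}(A)=\bigcup_{x\in A}F_{\mathcal V}(x)$. A solution is a map $\rho:I\to X$ on a $\mathbb Z$-interval with $\rho(t+1)\in F_{\mathcal V}(\rho(t))$; a path is a solution with bounded domain (single points are paths). A full solution $\varphi:\mathbb Z\to X$ is essential if for every $t$ there are $s>t$ and $s'<t$ such that for each $r\in\{s,s'\}$: $[\varphi(r)]_{\mathcal V}\ne[\varphi(t)]_{\mathcal V}$ or $[\varphi(r)]_{\mathcal V}$ is critical. $\operatorname{Inv}_{\mathcal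 V}A$ is the set of $x\in A$ lying on an essential solution with image in $A$. $N\subset X$ is an isolating block if $x,z\in N$, $y\in F_{\mathcal V}(x)$, $z\in F_{\mathcal V}(y)$ imply $y\in N$. A set $S$ is an isolated invariant set if $\operatorname{Inv}_{\mathcal V}S=S$ and $S=\operatorname{Inv}_{\mathcal V}N$ for some isolating block $N$. Block decompositions. For a full solution, $\operatorname{uim}^-\varphi=\bigcap_{t<0}\varphi((-\infty,t])$, $\operatorname{uim}^+\varphi=\bigcap_{t>0}\varphi([t,\infty))$. A block decomposition of $S\subset X$ in $\mathcal V$ is a family $\mathcal B=\{B_p\}_{p\in P}$ of mutually disjoint non-empty isolating blocks (in $S$) admitting a partial order on $P$ such that (B1) every essential $\varphi$ in $S$ has $\operatorname{uim}^-\varphi\subset B_p$, $\operatorname{uim}^+\varphi\subset B_q$ for some $p,q$; (B2) if a path in $S$ starts in $B_p$ and ends in $B_q$ then either $p>q$, or $p=q$ and the path stays in $B_p$. The least such order is the flow induced order. ''For $\mathcal V$'' means of $X$ in $\mathcal V$. Write $(\mathcal B,\mathcal V)\sqsubseteq(\mathcal B',\mathcal V')$ if every multivector of $\mathcal V$ is contained in one of $\mathcal V'$ and every block of $\mathcal B$ is contained in one of $\mathcal B'$; the indexing map $\iota:P\to P'$ is given by $B_p\subset B'_{\iota(p)}$. A zigzag filtration of block decompositions is a sequence $\mathfrak B=\{(\mathcal B_\lambda,\mathcal V_\lambda)\}_{\lambda=0}^T$, with $\mathcal B_\lambda=\{B_{p,\lambda}\}_{p\in P_\lambda}$ a block decomposition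 for $\mathcal V_\lambda$ and consecutive terms related by $\sqsubseteq$ or $\sqsupseteq$. It is basic if all fibres of all indexing maps have at most 2 elements. Index pairs and triples. Closed sets $E\subset P$ form an index pair $(P,E)$ for $S$ in $\mathcal V$ if $F_{\mathcal V}(P\setminus E)\subset P$, $F_{\mathcal V}(E)\cap P\subset E$, $S=\operatorname{Inv}_{\mathcal V}(P\setminus E)$. Given a block decomposition $\{B_a,B_r\}$, $r\not<a$, of an isolating block $B$ in $\mathcal V$, an index triple is a triple of closed sets $N_0\subset N_1\subset N_2$ such that $(N_1,N_0)$, $(N_2,N_1)$, $(N_2,N_0)$ are index pairs for $\operatorname{Inv}B_a,\operatorname{Inv}B_r,\operatorname{Inv}B$ and $B_a\subset N_1\setminus N_0$, $B_r\subset N_2\setminus N_1$, $B\subset N_2\setminus N_0$. Its AR-split diagram consists of the inclusions $i:(N_1,N_0)\to(N_2,N_0)$, $j:(N_2,N_0)\to(N_2,N_1)$ and the (vertical) composite. Connecting sequence. Let $\operatorname{pf}_{\mathcal V}(A,Y)$ be the set of endpoints of paths in $Y$ starting in $A$. If $(P,E)$, $(P',E')$ are index pairs for $S$ and $B$ is an isolating block with $\operatorname{Inv}B=S$, $B\subset(P\setminus E)\cap(P'\setminus E')$, the connecting sequence is $(P,E)\supset(\operatorname{pf}(\operatorname{cl}B,P),E\cap\operatorname{pf}(\operatorname{mo}B,P))\subset(\operatorname{pf}(\operatorname{cl}B,P),\operatorname{pf}(\operatorname{mo}B,P))\supset(\operatorname{cl}B,\operatorname{mo}B)$ followed by the mirror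 image of the analogous sequence from $(P',E')$. All terms are index pairs for $S$ and all inclusions induce isomorphisms in homology. Transition diagram of a basic $\mathfrak B$. (1) Transition step: for each $\lambda$ with $(\mathcal B_\lambda,\mathcal V_\lambda)\sqsubseteq(\mathcal B_{\lambda+1},\mathcal V_{\lambda+1})$ and each $q\in P_{\lambda+1}$: if $\iota^{-1}(q)=\{p_0,p_1\}$, choose an index triple for the block decomposition $\{B_{p_0,\lambda},B_{p_1,\lambda}\}$ of $B_{q,\lambda+1}$ in $\mathcal V_\lambda$ with $(N_2,N_0)$ also an index pair for $\operatorname{Inv}_{\mathcal V_{\lambda+1}}B_{q,\lambda+1}$ in $\mathcal V_{\lambda+1}$; put $(N_1,N_0)$, $(N_2,N_1)$ in the column of $\mathcal B_\lambda$ and $(N_2,N_0)$ in the column of $\mathcal B_{\lambda+1}$, with the arrows of the AR-split diagram. If $\iota^{-1}(q)=\{p\}$, choose a common index pair $(P,E)$ for $\operatorname{Inv}_{\mathcal V_{\lambda+1}}B_{q,\lambda+1}$ in $\mathcal V_{\lambda+1}$ and $\operatorname{Inv}_{\mathcal V_\lambda}B_{p,\lambda}$ in $\mathcal V_\lambda$ with $B_{q,\lambda+1}\subset P\setminus E$, placed in both columns and joined by equality (one arrow). If $\iota^{-1}(q)=\emptyset$, choose an index pair $(P,E)$ for $\operatorname{Inv}_{\mathcal V_{\lambda+1}}B_{q,\lambda+1}$ with $B_{q,\lambda+1}\subset P\setminus E$. The case $\sqsupseteq$ is symmetric (roles of $\lambda$ and $\lambda+1$ exchanged). (2) Aligning step: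 each block with $0<\lambda<T$ has received two index pairs, one from each side; they are joined by a connecting sequence, whose terms occupy additional successive columns. Equal pairs at different positions are different nodes. Non-basic $\mathfrak B$. Each step $(\mathcal B_\lambda,\mathcal V_\lambda)\sqsubseteq(\mathcal B_{\lambda+1},\mathcal V_{\lambda+1})$ is replaced by an AR-cascade: a basic filtration $(\mathcal B_\lambda,\mathcal V_\lambda)\sqsubseteq(\mathcal B_{\lambda''},\mathcal V_\lambda)\sqsubseteq\dots\sqsubseteq(\mathcal B_{\lambda^{(n)}},\mathcal V_\lambda)\sqsubseteq(\mathcal B_{\lambda+1},\mathcal V_{\lambda+1})$; symmetrically for $\sqsupseteq$ (intermediate terms for $\mathcal V_{\lambda+1}$). A transition diagram for $\mathfrak B$ is one for such a basic zigzag filtration. The digraph of $\mathfrak{TD}$ is acyclic; its transitive closure is the induced partial order, whose Hasse diagram (arrows directed along inclusions) is regarded as a quiver $Q$. The Conley–Morse persistence module $\mathbb M$ is obtained by applying relative homology (in each degree) to $\mathfrak{TD}$. $I$ is generated by the paths ''$i$ followed by $j$'' of all AR-split diagrams in $\mathfrak{TD}$. Strings. For an arrow $\alpha$ with source $s(\alpha)$, target $e(\alpha)$, $\alpha^-$ is its formal reverse. Paths are written with the first arrow first. A string of $(Q,I)$ is a sequence $\alpha_1^{\ell_1}\cdots\alpha_n^{\ell_n}$, $\ell_i=\pm1$ (exponent $-1$ is the formal reverse), with $e(\alpha_i^{\ell_i})=s(\alpha_{i+1}^{\ell_{i+1}})$, $\alpha_i^{\ell_i}\neq(\alpha_{i+1}^{\ell_{i+1}})^-$,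 and such that no consecutive subsequence of it or of its formal reverse is in $I$; there is also a trivial string at each node. Strings are taken modulo reversal. The string module $\mathbb S_u$ has $\mathbb S_u(a)=k$ if $u$ passes through node $a$ and $0$ otherwise, with identity maps along arrows through which $u$ passes and zero maps otherwise. *)

(* Defs.v *)
From HB Require Import structures.
From Stdlib Require Import Relations.
From mathcomp Require Import all_boot all_order all_algebra.
From mathcomp Require Import all_classical all_reals topology.
From mathcomp.multinomials Require Import freeg.

Set Implicit Arguments.
Unset Strict Implicit.
Unset Printing Implicit Defensive.

Import Order.TTheory GRing.Theory Num.Theory numFieldTopology.Exports.

Local Open Scope classical_set_scope.
Local Open Scope ring_scope.

Section Subquotient.
Variables (k : fieldType) (V : lmodType k).

Definition submod_sort (Z : submodClosed V) := {v : V | v \in Z}.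

HB.instance Definition _ (Z : submodClosed V) := SubChoice.on (submod_sort Z).
HB.instance Definition _ (Z : submodClosed V) :=
  [SubChoice_isSubLmodule of submod_sort Z by <:].

Variables (Z B : submodClosed V).

Fact submod_valP a (x y : submod_sort Z) : val (a *: x + y) = a *: val x + val y.
Proof. exact: linearP. Qed.

Fact submod_valZ a (x : submod_sort Z) : val (a *: x) = a *: val x.
Proof. exact: linearZ. Qed.

Definition submod_restr : {pred submod_sort Z} := [pred z | val z \in B].

Fact submod_restr_closed : submod_closed submod_restr.
Proof.
split=> [|a x y]; rewrite !inE ?raddf0 ?rpred0 // => xB yB.
by rewrite submod_valP rpredD // rpredZ.
Qed.

HB.instance Definition _ :=
  GRing.isSubmodClosed.Build k (submod_sort Z) submod_restr submod_restr_closed.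

(* The quotient of Z by its intersection with B. *)
Definition subquot := Quotient.quot submod_restr.

HB.instance Definition _ := GRing.Zmodule.on subquot.

Definition subquot_class (z : submod_sort Z) : subquot := \pi_(Quotient.quot submod_restr)%qT z.
Definition subquot_repr (x : subquot) : submod_sort Z := repr (x : Quotient.quot submod_restr).

Lemma subquot_reprK x : subquot_class (subquot_repr x) = x.
Proof. exact: reprK. Qed.

Lemma subquot_classD : {morph subquot_class : x y / x + y}.
Proof. exact: (@raddfD _ _ (\pi_(Quotient.quot submod_restr)%qT)). Qed.

Lemma subquot_classE x y :
  (subquot_class x = subquot_class y) <-> (val x - val y \in B).
Proof.
rewrite -raddfB.
have -> : (val (x - y) \in B) = ((x - y) \in submod_restr) by [].
by rewrite Quotient.idealrBE; split => [e|/eqP]; first exact: (introT eqP e).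
Qed.

Definition subquot_scale (a : k) (x : subquot) : subquot :=
  subquot_class (a *: subquot_repr x).

Lemma subquot_scaleE a z :
  subquot_scale a (subquot_class z) = subquot_class (a *: z).
Proof.
apply/subquot_classE.
rewrite !submod_valZ -scalerBr rpredZ //.
by apply/subquot_classE; rewrite subquot_reprK.
Qed.

Fact subquot_scaleA a b x :
  subquot_scale a (subquot_scale b x) = subquot_scale (a * b) x.
Proof. by rewrite -[x]subquot_reprK !subquot_scaleE scalerA. Qed.

Fact subquot_scale1 : left_id 1 subquot_scale.
Proof. by move=> x; rewrite -[x]subquot_reprK subquot_scaleE scale1r. Qed.

Fact subquot_scaleDr : right_distributive subquot_scale +%R.
Proof.
move=> a x y; rewrite -[x]subquot_reprK -[y]subquot_reprK.
by rewrite -subquot_classD !subquot_scaleE scalerDr subquot_classD.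
Qed.

Fact subquot_scaleDl x : {morph subquot_scale^~ x : a b / a + b}.
Proof.
move=> a b; rewrite -[x]subquot_reprK !subquot_scaleE.
by rewrite scalerDl subquot_classD.
Qed.

HB.instance Definition _ := GRing.Zmodule_isLmodule.Build k subquot
  subquot_scaleA subquot_scale1 subquot_scaleDr subquot_scaleDl.

Fact subquot_class_linear : linear subquot_class.
Proof.
by move=> a x y; rewrite subquot_classD -subquot_scaleE.
Qed.

End Subquotient.

Section SubquotientMap.
Variables (k : fieldType) (V : lmodType k) (Z B Z' B' : submodClosed V).
Hypotheses (sZ : {subset Z <= Z'}) (sB : {subset B <= B'}).

Definition submod_incl (z : submod_sort Z) : submod_sort Z' :=
  Sub (val z) (sZ (valP z)).

Definition subquot_map (x : subquot Z B) : subquot Z' B' :=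
  subquot_class B' (submod_incl (subquot_repr x)).

Lemma subquot_mapE z :
  subquot_map (subquot_class B z) = subquot_class B' (submod_incl z).
Proof.
apply/subquot_classE; rewrite !SubK; apply: sB.
by apply/subquot_classE; rewrite subquot_reprK.
Qed.

Fact subquot_map_linear : linear subquot_map.
Proof.
move=> a x y; rewrite -[x]subquot_reprK -[y]subquot_reprK.
rewrite -subquot_class_linear !subquot_mapE -subquot_class_linear.
by congr subquot_class; apply: val_inj; rewrite !(SubK, linearP).
Qed.

Definition subquot_hom : {linear subquot Z B -> subquot Z' B'} :=
  HB.pack subquot_map (GRing.isLinear.Build k (subquot Z B) (subquot Z' B') *:%R
    subquot_map subquot_map_linear).

End SubquotientMap.

Section Fglift.
Variables (k : fieldType) (K : choiceType) (M : lmodType k) (f : K -> M).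

HB.instance Definition _ :=
  GRing.isZmodMorphism.Build {freeg K / k} M (fglift f) (lift_is_additive f).

Fact fglift_scalable : scalable (fglift f : {freeg K / k} -> M).
Proof.
move=> a x.
have fE y : fglift f y = \sum_(z <- dom y) fglift f << coeff z y *g z >>.
  by rewrite -raddf_sum freeg_sumE.
rewrite [fglift f x]fE -{1}(freeg_sumE x) !scaler_sumr raddf_sum.
apply: eq_bigr => z _; rewrite liftU scalerA.
have -> : a *: << coeff z x *g z >> = << (a * coeff z x) *g z >> :> {freeg K / k}.
  by apply/eqP/freeg_eqP => w; rewrite coeffZ !coeffU mulrA.
exact: liftU.
Qed.

HB.instance Definition _ :=
  GRing.isScalable.Build k {freeg K / k} M *:%R (fglift f) fglift_scalable.

End Fglift.

Section SingularHomology.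
Variables (R : realType) (k : fieldType) (X : topologicalType).

Definition stdsimplex n : set 'rV[R]_n.+1 :=
  [set x | (forall i, 0 <= x 0 i) /\ \sum_i x 0 i = 1].
Arguments stdsimplex n : clear implicits.

Definition coface n (i : 'I_n.+2) (x : 'rV[R]_n.+1) : 'rV[R]_n.+2 :=
  \row_j (if unlift i j is Some j' then x 0 j' else 0).

Fact coface_stdsimplex n (i : 'I_n.+2) (x : stdsimplex n) :
  coface i (val x) \in stdsimplex n.+1.
Proof.
have /set_mem [x_ge0 x_sum] := valP x.
rewrite inE; split => [j|]; first by rewrite mxE; case: unliftP.
rewrite (bigD1_ord i) //= mxE unlift_none add0r -[RHS]x_sum.
by apply: eq_bigr => j _; rewrite mxE liftK.
Qed.

Definition coface_map n (i : 'I_n.+2) (x : stdsimplex n) : stdsimplex n.+1 :=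
  SigSub (coface_stdsimplex i x).

(* Chains are combinations of arbitrary functions from the simplex to X;
   [chain_in A] is the space of singular chains of A. *)
Definition sing n := {classic stdsimplex n -> X}.
Definition chain n := {freeg (sing n) / k}.

Definition chain_in n (A : set X) (c : chain n) : Prop :=
  forall s : sing n, s \in dom c ->
    continuous (s : stdsimplex n -> X) /\ range (s : stdsimplex n -> X) `<=` A.

Definition face n (i : 'I_n.+2) (s : sing n.+1) : sing n :=
  (s : stdsimplex n.+1 -> X) \o coface_map i.

Definition bdry n : chain n -> chain n.-1 :=
  match n with
  | 0 => fun=> 0
  | m.+1 => fglift (fun s : sing m.+1 =>
      \sum_(i < m.+2) (-1) ^+ i *: (<< face i s >> : chain m))
  end.

Fact bdry_linear n : linear (@bdry n).
Proof.
case: n => [|n] a x y /=; last exact: linearP.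
by rewrite scaler0 addr0.
Qed.

HB.instance Definition _ n :=
  GRing.isLinear.Build k (chain n) (chain n.-1) *:%R (@bdry n) (@bdry_linear n).

Fact chain_in0 n A : @chain_in n A 0.
Proof. by move=> s; rewrite dom0. Qed.

Fact chain_inP n A a (x y : chain n) :
  chain_in A x -> chain_in A y -> chain_in A (a *: x + y).
Proof.
move=> Ax Ay s; rewrite mem_dom coeffD coeffZ => nz.
have [/Ax//|xs] := boolP (s \in dom x).
have [/Ay//|ys] := boolP (s \in dom y).
by move: nz; rewrite !coeff_outdom // mulr0 addr0 eqxx.
Qed.

(* A pair (A, B) of subspaces, B being contained in A in all uses. *)
Definition spair := (set X * set X)%type.

Definition pair_le (p q : spair) := p.1 `<=` q.1 /\ p.2 `<=` q.2.

Variable n : nat.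

(* With p = (A, B): c is a relative cycle when it is a chain of A with boundary
   in B, a relative boundary when it is the boundary of a chain of A plus a
   chain of B.  Relative boundaries are relative cycles, so that [homology] is
   the n-th relative singular homology, over k, of p. *)
Definition cycle (p : spair) : {pred chain n} :=
  [pred c | `[< chain_in p.1 c /\ chain_in p.2 (bdry c) >]].

Definition boundary (p : spair) : {pred chain n} :=
  [pred c | `[< exists a : chain n.+1, exists b : chain n,
     [/\ chain_in p.1 a, chain_in p.2 b & c = bdry a + b] >]].

Fact cycle_closed p : submod_closed (cycle p).
Proof.
split=> [|a x y].
  apply/asboolP; split; first exact: chain_in0.
  by rewrite linear0; exact: chain_in0.
move=> /asboolP[x1 x2] /asboolP[y1 y2]; apply/asboolP.
by split; [exact: chain_inP|rewrite linearP; exact: chain_inP].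
Qed.

Fact boundary_closed p : submod_closed (boundary p).
Proof.
split=> [|a x y].
  apply/asboolP; exists 0, 0; split; try exact: chain_in0.
  by rewrite addr0 (linear0 (@bdry n.+1)).
move=> /asboolP[x1 [x2 [Ax1 Ax2 ->]]] /asboolP[y1 [y2 [Ay1 Ay2 ->]]].
apply/asboolP; exists (a *: x1 + y1), (a *: x2 + y2).
split; try exact: chain_inP.
by rewrite (linearP (@bdry n.+1)) scalerDr addrACA.
Qed.

HB.instance Definition _ p :=
  GRing.isSubmodClosed.Build k (chain n) (cycle p) (cycle_closed p).
HB.instance Definition _ p :=
  GRing.isSubmodClosed.Build k (chain n) (boundary p) (boundary_closed p).

Definition homology (p : spair) : lmodType k := subquot (cycle p) (boundary p).

Fact chain_in_sub m (A B : set X) (c : chain m) :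
  A `<=` B -> chain_in A c -> chain_in B c.
Proof. by move=> AB Ac s /Ac[? sA]; split=> //; apply: subset_trans AB. Qed.

Fact cycle_sub p q : pair_le p q -> {subset cycle p <= cycle q}.
Proof.
by move=> [le1 le2] c /asboolP[c1 c2]; apply/asboolP; split;
  [exact: chain_in_sub c1|exact: chain_in_sub c2].
Qed.

Fact boundary_sub p q : pair_le p q -> {subset boundary p <= boundary q}.
Proof.
move=> [le1 le2] c /asboolP[a [b [pa pb ->]]]; apply/asboolP; exists a, b.
by split=> //; [exact: chain_in_sub pa|exact: chain_in_sub pb].
Qed.

Definition homology_map p q (pq : pair_le p q) :
  {linear homology p -> homology q} :=
  @subquot_hom k (chain n) (cycle p) (boundary p) (cycle q) (boundary q)
    (cycle_sub pq) (boundary_sub pq).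

End SingularHomology.

Arguments spair : clear implicits.

Section MultivectorField.
Variables (R : realType) (k : fieldType) (X : topologicalType).

Definition mouth (A : set X) : set X := closure A `\` A.

Definition locally_closed (A : set X) := closed (mouth A).

Definition mvfield (V : set (set X)) : Prop :=
  [/\ forall W, V W -> W !=set0 /\ locally_closed W,
      forall W W', V W -> V W' -> W `&` W' !=set0 -> W = W' &
      \bigcup_(W in V) W = setT].

Variable V : set (set X).

Definition mvcell (x : X) : set X := \bigcup_(W in [set W | V W /\ W x]) W.

Definition regular (W : set X) : Prop :=
  forall n (h : homology R k n (closure W, mouth W)), h = 0.

Definition critical (W : set X) : Prop := ~ regular W.

Definition Fmv (x : X) : set X := closure [set x] `|` mvcell x.

Definition Fmv_set (A : set X) : set X := \bigcup_(x in A) Fmv x.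

(* A path is a solution on the interval [a, b]; the values of rho outside of
   this interval are irrelevant. *)
Definition is_path (a b : int) (rho : int -> X) : Prop :=
  a <= b /\ forall t, a <= t -> t < b -> Fmv (rho t) (rho (t + 1)).

Definition path_in (Y : set X) (a b : int) (rho : int -> X) : Prop :=
  is_path a b rho /\ forall t, a <= t -> t <= b -> Y (rho t).

Definition full_solution (phi : int -> X) : Prop :=
  forall t, Fmv (phi t) (phi (t + 1)).

Definition essential (phi : int -> X) : Prop :=
  full_solution phi /\
  forall t, exists s s', [/\ t < s, s' < t &
    forall r, r = s \/ r = s' ->
      mvcell (phi r) <> mvcell (phi t) \/ critical (mvcell (phi r))].

Definition essential_in (A : set X) (phi : int -> X) : Prop :=
  essential phi /\ range phi `<=` A.

Definition Inv (A : set X) : set X :=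
  [set x | exists2 phi, essential_in A phi & range phi x].

Definition isolating_block (N : set X) : Prop :=
  forall x y z, N x -> N z -> Fmv x y -> Fmv y z -> N y.

Definition uim_minus (phi : int -> X) : set X :=
  \bigcap_(t in [set t : int | t < 0]) (phi @` [set s | s <= t]).

Definition uim_plus (phi : int -> X) : set X :=
  \bigcap_(t in [set t : int | 0 < t]) (phi @` [set s | t <= s]).

Definition partial_order (P : Type) (le : P -> P -> Prop) : Prop :=
  [/\ forall p, le p p,
      forall p q, le p q -> le q p -> p = q &
      forall p q r, le p q -> le q r -> le p r].

Definition admissible_order (S : set X) (P : Type) (B : P -> set X)
    (le : P -> P -> Prop) : Prop :=
  partial_order le /\
  forall p q a b rho, path_in S a b rho -> B p (rho a) -> B q (rho b) ->
    (le q p /\ q <> p) \/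
    (p = q /\ forall t, a <= t -> t <= b -> B p (rho t)).

Definition block_decomposition (S : set X) (P : Type) (B : P -> set X) : Prop :=
  [/\ forall p, [/\ B p !=set0, isolating_block (B p) & B p `<=` S],
      forall p q, p <> q -> B p `&` B q = set0,
      forall phi, essential_in S phi ->
        exists p q, uim_minus phi `<=` B p /\ uim_plus phi `<=` B q &
      exists le, admissible_order S B le].

(* The least admissible order. *)
Definition flow_order (S : set X) (P : Type) (B : P -> set X) : P -> P -> Prop :=
  fun p q => forall le, admissible_order S B le -> le p q.

Definition index_pair (S P E : set X) : Prop :=
  [/\ closed P /\ closed E, E `<=` P, Fmv_set (P `\` E) `<=` P,
      Fmv_set E `&` P `<=` E & S = Inv (P `\` E)].

Definition pair_family (Ba Br : set X) : bool -> set X :=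
  fun r => if r then Br else Ba.

Definition index_triple (B Ba Br N0 N1 N2 : set X) : Prop :=
  [/\ [/\ isolating_block B,
          block_decomposition B (pair_family Ba Br) &
          ~ flow_order B (pair_family Ba Br) true false],
      [/\ closed N0, closed N1, closed N2, N0 `<=` N1 & N1 `<=` N2],
      [/\ index_pair (Inv Ba) N1 N0,
          index_pair (Inv Br) N2 N1 &
          index_pair (Inv B) N2 N0] &
      [/\ Ba `<=` N1 `\` N0, Br `<=` N2 `\` N1 & B `<=` N2 `\` N0]].

Definition pf (A Y : set X) : set X :=
  [set y | exists a b rho, [/\ path_in Y a b rho, A (rho a) & rho b = y]].

(* The five pairs strictly between (P, E) and (P', E') in the connecting
   sequence. *)
Inductive cterm := C1 | C2 | C3 | C4 | C5.

Definition cterm_pair (B : set X) (PE PE' : spair X) (c : cterm) : spair X :=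
  match c with
  | C1 => (pf (closure B) PE.1, PE.2 `&` pf (mouth B) PE.1)
  | C2 => (pf (closure B) PE.1, pf (mouth B) PE.1)
  | C3 => (closure B, mouth B)
  | C4 => (pf (closure B) PE'.1, pf (mouth B) PE'.1)
  | C5 => (pf (closure B) PE'.1, PE'.2 `&` pf (mouth B) PE'.1)
  end.

Lemma subset_pf (A Y : set X) : A `<=` Y -> A `<=` pf A Y.
Proof.
move=> AY x Ax; exists 0, 0, (fun=> x); split=> //; split; last by move=> *; exact: AY.
by split=> // t t0 /(le_lt_trans t0); rewrite ltxx.
Qed.

Lemma pf_subset (A Y : set X) : pf A Y `<=` Y.
Proof. by move=> y [a [b [rho [[[ab _] rhoY] _ <-]]]]; exact: rhoY. Qed.

End MultivectorField.

Section Zigzag.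
Variables (R : realType) (k : fieldType) (X : topologicalType).

(* A family of blocks together with a multivector field.  Blocks being
   non-empty and disjoint in a finite space, the index type is finite. *)
Record bterm := BTerm {
  mvf : set (set X);
  idx : finType;
  blk : idx -> set X }.

Definition indexing_map (s t : bterm) (iota : idx s -> idx t) : Prop :=
  forall p, blk p `<=` blk (iota p).

Definition finer (s t : bterm) : Prop :=
  (forall W, mvf s W -> exists2 W', mvf t W' & W `<=` W') /\
  (forall p : idx s, exists q : idx t, blk p `<=` blk q).

(* The terms are those of index l <= len; [fwd l] tells in which direction the
   terms l and l.+1 are compared. *)
Record zigzag := Zigzag {
  len : nat;
  term : nat -> bterm;
  fwd : nat -> bool }.

Definition fine_of (b : bool) (s t : bterm) := if b then s else t.
Definition coarse_of (b : bool) (s t : bterm) := if b then t else s.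
Definition fine (Z : zigzag) l := fine_of (fwd Z l) (term Z l) (term Z l.+1).
Definition coarse (Z : zigzag) l := coarse_of (fwd Z l) (term Z l) (term Z l.+1).

Definition zigzag_filtration (Z : zigzag) : Prop :=
  (forall l, (l <= len Z)%N -> mvfield (mvf (term Z l)) /\
     block_decomposition R k (mvf (term Z l)) setT (@blk (term Z l))) /\
  (forall l, (l < len Z)%N -> finer (fine Z l) (coarse Z l)).

Definition basic (Z : zigzag) : Prop :=
  forall l, (l < len Z)%N ->
  forall iota, @indexing_map (fine Z l) (coarse Z l) iota ->
  forall q, (#|[pred p | iota p == q]| <= 2)%N.

(* Z' is obtained from Z by inserting, between the terms l and l.+1 of Z, terms
   which all carry the multivector field of the finer of the two; the term l
   of Z becomes the term (f l) of Z'. *)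
Definition ar_cascades (Z Z' : zigzag) : Prop :=
  exists f : nat -> nat,
    [/\ f 0%N = 0%N, f (len Z) = len Z',
        forall l, (l <= len Z)%N -> term Z' (f l) = term Z l &
        forall l, (l < len Z)%N -> (f l < f l.+1)%N /\
          forall m, (f l <= m < f l.+1)%N ->
            fwd Z' m = fwd Z l /\ mvf (fine Z' m) = mvf (fine Z l)].

Definition basic_form (Z Z' : zigzag) : Prop :=
  (basic Z /\ Z' = Z) \/
  [/\ ~ basic Z, zigzag_filtration Z', basic Z' & ar_cascades Z Z'].

(* Choices made at a block of the coarser term of a step: an attractor, a
   repeller and an index triple; or an index pair common to two blocks, with
   the direction of the equality arrow; or an index pair for a new block. *)
Inductive choice_at (I : Type) :=
  | Split (a r : I) (N0 N1 N2 : set X)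
  | Single (PE : spair X) (to_coarse : bool)
  | Birth (PE : spair X).

Record tstep (s t : bterm) := TStep {
  ind : idx s -> idx t;
  cho : idx t -> choice_at (idx s) }.

Definition good_choice (s t : bterm) (d : tstep s t) (q : idx t) : Prop :=
  match cho d q with
  | Split a r N0 N1 N2 =>
    [/\ a <> r, forall p, ind d p = q <-> p = a \/ p = r,
        index_triple R k (mvf s) (blk q) (blk a) (blk r) N0 N1 N2 &
        index_pair R k (mvf t) (Inv R k (mvf t) (blk q)) N2 N0]
  | Single PE _ =>
    [/\ exists2 p, forall p', ind d p' = q <-> p' = p &
          index_pair R k (mvf s) (Inv R k (mvf s) (blk p)) PE.1 PE.2,
        index_pair R k (mvf t) (Inv R k (mvf t) (blk q)) PE.1 PE.2 &
        blk q `<=` PE.1 `\` PE.2]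
  | Birth PE =>
    [/\ forall p, ind d p <> q,
        index_pair R k (mvf t) (Inv R k (mvf t) (blk q)) PE.1 PE.2 &
        blk q `<=` PE.1 `\` PE.2]
  end.

Definition transition_step (s t : bterm) (d : tstep s t) : Prop :=
  indexing_map (ind d) /\ forall q, good_choice d q.

Definition coarse_pair (s t : bterm) (d : tstep s t) (q : idx t) : spair X :=
  match cho d q with
  | Split _ _ N0 _ N2 => (N2, N0)
  | Single PE _ | Birth PE => PE
  end.

Definition fine_pair (s t : bterm) (d : tstep s t) (p : idx s) : spair X :=
  match cho d (ind d p) with
  | Split a _ N0 N1 N2 => if p == a then (N1, N0) else (N2, N1)
  | Single PE _ | Birth PE => PE
  end.

Definition pair_at (s t : bterm) (d : tstep s t) (x : idx s + idx t) : spair X :=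
  match x with inl p => fine_pair d p | inr q => coarse_pair d q end.

Definition block_at (s t : bterm) (x : idx s + idx t) : set X :=
  match x with inl p => blk p | inr q => blk q end.

Lemma pair_at_block (s t : bterm) (d : tstep s t) (x : idx s + idx t) :
  transition_step d -> closed (pair_at d x).1 /\ block_at x `<=` (pair_at d x).1.
Proof.
move=> [inc gd]; case: x => [p|q] /=.
  have := gd (ind d p); rewrite /good_choice /fine_pair.
  case: (cho d _) => [a r N0 N1 N2|PE b|PE] /=.
  - move=> [_ fib [_ [_ cN1 cN2 _ _] _ [aN rN _]] _].
    have [pa|npa] := eqVneq p a; first by rewrite pa; split=> // x /aN[].
    have [/(_ erefl)[pE|->] _] := fib p; first by rewrite pE eqxx in npa.
    by split=> // x /rN[].
  - by move=> [_ [[]] ? _ _ _ _ _ qP]; split=> // x /inc /qP[].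
  - by move=> [/(_ p)].
have := gd q; rewrite /good_choice /coarse_pair.
case: (cho d _) => [a r N0 N1 N2|PE b|PE] /=.
- by move=> [_ _ [_ [_ _ cN2 _ _] _ [_ _ qN]] _]; split=> // x /qN[].
- by move=> [_ [[]] ? _ _ _ _ _ qP]; split=> // x /qP[].
- by move=> [_ [[]] ? _ _ _ _ _ qP]; split=> // x /qP[].
Qed.

(* The two terms of a step from s to t, whose finer term is s if b and t
   otherwise, and the position of their blocks among the finer and coarser. *)
Definition left_pos b (s t : bterm) (p : idx s) :
    idx (fine_of b s t) + idx (coarse_of b s t) :=
  match b with true => inl p | false => inr p end.

Definition right_pos b (s t : bterm) (p : idx t) :
    idx (fine_of b s t) + idx (coarse_of b s t) :=
  match b with true => inr p | false => inl p end.

Fact left_pos_block b (s t : bterm) (p : idx s) :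
  block_at (left_pos b t p) = blk p.
Proof. by case: b. Qed.

Fact right_pos_block b (s t : bterm) (p : idx t) :
  block_at (right_pos b s p) = blk p.
Proof. by case: b. Qed.

Section Diagram.
Variables (Z : zigzag) (d : forall l : 'I_(len Z), tstep (fine Z l) (coarse Z l)).

Inductive node :=
  | TNode (l : 'I_(len Z)) (x : idx (fine Z l) + idx (coarse Z l))
  | ANode (l : 'I_(len Z).-1) (p : idx (term Z l.+1)) (c : cterm).

Fact next_step_subproof (l : 'I_(len Z).-1) : (l.+1 < len Z)%N.
Proof. by case: (len Z) l => [[]|n []]. Qed.

Definition this_step (l : 'I_(len Z).-1) : 'I_(len Z) :=
  widen_ord (leq_pred _) l.
Definition next_step (l : 'I_(len Z).-1) : 'I_(len Z) :=
  Ordinal (next_step_subproof l).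

(* The two ends of the connecting sequence of a block of the term l.+1. *)
Definition left_end (l : 'I_(len Z).-1) (p : idx (term Z l.+1)) : node :=
  @TNode (this_step l) (right_pos (fwd Z l) (term Z l) p).
Definition right_end (l : 'I_(len Z).-1) (p : idx (term Z l.+1)) : node :=
  @TNode (next_step l) (left_pos (fwd Z l.+1) (term Z l.+2) p).

Definition node_pair (x : node) : spair X :=
  match x with
  | TNode l x => pair_at (d l) x
  | ANode l p c =>
    cterm_pair (mvf (term Z l.+1)) (blk p)
      (pair_at (d (this_step l)) (right_pos (fwd Z l) (term Z l) p))
      (pair_at (d (next_step l)) (left_pos (fwd Z l.+1) (term Z l.+2) p)) c
  end.

(* edge_cij goes from the term i to the term j of a connecting sequence, whose
   terms 0 and 6 are its ends. *)
Inductive edge : node -> node -> Prop :=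
  | edge_i l q a r N0 N1 N2 of cho (d l) q = Split a r N0 N1 N2 :
      edge (@TNode l (inl a)) (@TNode l (inr q))
  | edge_j l q a r N0 N1 N2 of cho (d l) q = Split a r N0 N1 N2 :
      edge (@TNode l (inr q)) (@TNode l (inl r))
  | edge_ij l q a r N0 N1 N2 of cho (d l) q = Split a r N0 N1 N2 :
      edge (@TNode l (inl a)) (@TNode l (inl r))
  | edge_up l p PE of cho (d l) (ind (d l) p) = Single _ PE true :
      edge (@TNode l (inl p)) (@TNode l (inr (ind (d l) p)))
  | edge_down l p PE of cho (d l) (ind (d l) p) = Single _ PE false :
      edge (@TNode l (inr (ind (d l) p))) (@TNode l (inl p))
  | edge_c10 l p : edge (@ANode l p C1) (left_end p)
  | edge_c12 l p : edge (@ANode l p C1) (@ANode l p C2)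
  | edge_c32 l p : edge (@ANode l p C3) (@ANode l p C2)
  | edge_c34 l p : edge (@ANode l p C3) (@ANode l p C4)
  | edge_c54 l p : edge (@ANode l p C5) (@ANode l p C4)
  | edge_c56 l p : edge (@ANode l p C5) (right_end p).

Definition td_lt : node -> node -> Prop := clos_trans node edge.

Definition hasse (x y : node) : Prop :=
  td_lt x y /\ ~ exists z, td_lt x z /\ td_lt z y.


Hypothesis good : forall l, transition_step (d l).

Lemma left_end_block (l : 'I_(len Z).-1) (p : idx (term Z l.+1)) :
  closed (node_pair (left_end p)).1 /\ blk p `<=` (node_pair (left_end p)).1.
Proof.
have := pair_at_block (right_pos (fwd Z l) (term Z l) p) (good (this_step l)).
by rewrite right_pos_block.
Qed.

Lemma right_end_block (l : 'I_(len Z).-1) (p : idx (term Z l.+1)) :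
  closed (node_pair (right_end p)).1 /\ blk p `<=` (node_pair (right_end p)).1.
Proof.
have := pair_at_block (left_pos (fwd Z l.+1) (term Z l.+2) p) (good (next_step l)).
by rewrite left_pos_block.
Qed.

Lemma cterm_pair_le V (B : set X) (PE PE' : spair X) :
  closed PE.1 -> B `<=` PE.1 -> closed PE'.1 -> B `<=` PE'.1 ->
  forall c, c = cterm_pair V B PE PE' ->
  [/\ pair_le (c C1) PE /\ pair_le (c C1) (c C2),
      pair_le (c C3) (c C2) /\ pair_le (c C3) (c C4) &
      pair_le (c C5) (c C4) /\ pair_le (c C5) PE'].
Proof.
move=> cP BP cP' BP' _ ->.
have clB P : closed P -> B `<=` P -> closure B `<=` P.
  by move=> /closure_id {2}->; exact: closure_subset.
have moB P : closed P -> B `<=` P -> mouth B `<=` P.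
  by move=> ? ?; apply: subset_trans (clB _ _ _) => // x [].
split; split; split=> //=; first [exact: pf_subset | exact: subIsetl
  | exact: subIsetr | by apply: subset_pf; auto].
Qed.

Lemma edge_le x y : edge x y -> pair_le (node_pair x) (node_pair y).
Proof.
have conn (l : 'I_(len Z).-1) (p : idx (term Z l.+1)) :=
  @cterm_pair_le (mvf (term Z l.+1)) (blk p) _ _
  (left_end_block p).1 (left_end_block p).2
  (right_end_block p).1 (right_end_block p).2 _ erefl.
have split_le l q a r N0 N1 N2 : cho (d l) q = Split a r N0 N1 N2 ->
    [/\ fine_pair (d l) a = (N1, N0), fine_pair (d l) r = (N2, N1),
        coarse_pair (d l) q = (N2, N0), N0 `<=` N1 & N1 `<=` N2].
  move=> e; have [_ /(_ q)] := good l; rewrite /good_choice e.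
  move=> [ar fib [_ [_ _ _ N01 N12] _ _] _].
  rewrite /fine_pair /coarse_pair e.
  have -> : ind (d l) a = q by apply/fib; left.
  have -> : ind (d l) r = q by apply/fib; right.
  by rewrite e eqxx; case: eqVneq => // ra; case: ar.
case: x y / => [l q a r N0 N1 N2 e|l q a r N0 N1 N2 e|l q a r N0 N1 N2 e|l p PE e|l p PE e
  |l p|l p|l p|l p|l p|l p].
- by have [/= -> _ -> ? ?] := split_le _ _ _ _ _ _ _ e; split.
- by have [/= _ -> -> ? ?] := split_le _ _ _ _ _ _ _ e; split.
- by have [/= -> -> _ ? ?] := split_le _ _ _ _ _ _ _ e; split.
- by rewrite /= /fine_pair /coarse_pair e; split.
- by rewrite /= /fine_pair /coarse_pair e; split.
- by have [[]] := conn l p.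
- by have [[]] := conn l p.
- by have [_ []] := conn l p.
- by have [_ []] := conn l p.
- by have [_ _ []] := conn l p.
- by have [_ _ []] := conn l p.
Qed.

Lemma td_lt_le x y : td_lt x y -> pair_le (node_pair x) (node_pair y).
Proof.
elim=> [u v|u v w _ [uv1 uv2] _ [vw1 vw2]]; first exact: edge_le.
by split; apply: subset_trans; eassumption.
Qed.

End Diagram.
End Zigzag.

Record quiver := Quiver {
  vtx : Type;
  arr : Type;
  src : arr -> vtx;
  tgt : arr -> vtx }.

Section Quiver.
Variables (k : fieldType) (Q : quiver).

Inductive qpath : vtx Q -> vtx Q -> Type :=
  | qnil a : qpath a a
  | qcons (al : arr Q) b of qpath (tgt al) b : qpath (src al) b.

Fixpoint qcat a b c (u : qpath a b) : qpath b c -> qpath a c :=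
  match u with
  | qnil _ => fun w => w
  | qcons al _ u' => fun w => qcons (qcat u' w)
  end.

Fixpoint arrows a b (w : qpath a b) : seq (arr Q) :=
  if w is qcons al _ w' then al :: arrows w' else [::].

(* The summand of the path algebra kQ spanned by the paths from a to b. *)
Definition kQ a b := {freeg {classic qpath a b} / k}.

Definition qpath_elt a b (w : qpath a b) : kQ a b := << (w : {classic _}) >>.

Definition qpath_mul a b c d (u : qpath a b) (x : kQ b c) (v : qpath c d) :
    kQ a d :=
  fglift (fun w : {classic qpath b c} => qpath_elt (qcat u (qcat w v))) x.

(* The two-sided ideal of kQ generated by a set of paths.  It is the direct sum
   of its intersections with the summands kQ a b. *)
Inductive ideal (G : forall a b, qpath a b -> Prop) :
    forall a b, kQ a b -> Prop :=
  | ideal_gen a b (w : qpath a b) of G a b w : ideal G (qpath_elt w)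
  | ideal0 a b : ideal G (0 : kQ a b)
  | idealP a b (c : k) (x y : kQ a b) of ideal G x & ideal G y :
      ideal G (c *: x + y)
  | idealM a b c d (u : qpath a b) (x : kQ b c) (v : qpath c d) of ideal G x :
      ideal G (qpath_mul u x v).

Record rep := Rep {
  rsp : vtx Q -> lmodType k;
  rmap : forall al, {linear rsp (src al) -> rsp (tgt al)} }.
Arguments rmap : clear implicits.

Fixpoint path_map (M : rep) a b (w : qpath a b) : rsp M a -> rsp M b :=
  match w with
  | qnil _ => id
  | qcons al _ w' => @path_map M _ _ w' \o rmap M al
  end.
Arguments path_map M {a b} w v.

Definition satisfies (M : rep) (I : forall a b, kQ a b -> Prop) : Prop :=
  forall a b (x : kQ a b), I a b x ->
  forall v, fglift (fun w : {classic qpath a b} => path_map M w v) x = 0.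

Definition is_rep_hom (M N : rep)
    (f : forall a, {linear rsp M a -> rsp N a}) : Prop :=
  forall al v, f (tgt al) (rmap M al v) = rmap N al (f (src al) v).

Definition rep_iso (M N : rep) : Prop :=
  exists2 f : forall a, {linear rsp M a -> rsp N a},
    is_rep_hom f & forall a, bijective (f a).

(* M is the direct sum of the N j, with the f j as inclusions. *)
Definition is_direct_sum (M : rep) (J : choiceType) (N : J -> rep)
    (f : forall j a, {linear rsp (N j) a -> rsp M a}) : Prop :=
  (forall j, is_rep_hom (f j)) /\
  forall a (v : rsp M a), exists! x : forall j, rsp (N j) a,
    finite_set [set j | x j <> 0] /\ v = \sum_(j \in [set: J]) f j a (x j).

(* Arrows (true) and their formal reverses (false). *)
Definition letter := (arr Q * bool)%type.
Definition lsrc (l : letter) := if l.2 then src l.1 else tgt l.1.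
Definition ltgt (l : letter) := if l.2 then tgt l.1 else src l.1.
Definition lrev (l : letter) : letter := (l.1, ~~ l.2).

(* A vertex and a sequence of letters starting there. *)
Definition qword := (vtx Q * seq letter)%type.

Fixpoint composable (a : vtx Q) (s : seq letter) : Prop :=
  if s is l :: s' then lsrc l = a /\ composable (ltgt l) s' else True.

Definition subword (t s : seq letter) : Prop :=
  exists s1 s2, s = s1 ++ t ++ s2.

Definition is_string (I : forall a b, kQ a b -> Prop) (u : qword) : Prop :=
  [/\ composable u.1 u.2,
      forall l l', subword [:: l; l'] u.2 -> l <> lrev l' &
      forall a b (w : qpath a b), I a b (qpath_elt w) ->
        let t := [seq (al, true) | al <- arrows w] in
        ~ subword t u.2 /\ ~ subword t (rev [seq lrev l | l <- u.2])].

Definition through_vtx (u : qword) (a : vtx Q) : Prop :=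
  a = u.1 \/ exists2 l, subword [:: l] u.2 & a = ltgt l.

Definition through_arr (u : qword) (al : arr Q) : Prop :=
  exists e, subword [:: (al, e)] u.2.

(* The spaces 0 and k are the row vectors of length 0 and 1; the identity of k is
   the 1 x 1 matrix with entry 1. *)
Definition string_dim (u : qword) (a : vtx Q) : nat := `[< through_vtx u a >].

Definition string_mx (u : qword) (al : arr Q) :
    'M[k]_(string_dim u (src al), string_dim u (tgt al)) :=
  if `[< through_arr u al >] then const_mx 1 else 0.

Definition string_module (u : qword) : rep :=
  @Rep (fun a => 'rV[k]_(string_dim u a)) (fun al => mulmxr (string_mx u al)).

Definition string_decomposition (I : forall a b, kQ a b -> Prop) (M : rep)
    (J : choiceType) (u : J -> qword)
    (f : forall j a, {linear rsp (string_module (u j)) a -> rsp M a}) : Prop :=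
  (forall j, is_string I (u j)) /\
  @is_direct_sum M J (fun j => string_module (u j)) f.

End Quiver.

Section TransitionDiagram.
Variables (R : realType) (k : fieldType) (X : topologicalType).

Record transition_diagram (Z : zigzag X) := TransitionDiagram {
  td_zigzag : zigzag X;
  td_basic_form : basic_form R k Z td_zigzag;
  td_step : forall l : 'I_(len td_zigzag),
    tstep (fine td_zigzag l) (coarse td_zigzag l);
  td_good : forall l, transition_step R k (td_step l) }.

Variables (Z : zigzag X) (D : transition_diagram Z).

Definition td_quiver : quiver :=
  @Quiver (node (td_zigzag D))
    {xy : node (td_zigzag D) * node (td_zigzag D) | hasse (@td_step Z D) xy.1 xy.2}
    (fun al => (sval al).1) (fun al => (sval al).2).

(* The paths i followed by j of the AR-splits. *)
Definition ar_path (a b : vtx td_quiver) (w : qpath a b) : Prop :=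
  exists l q a r N0 N1 N2 (al be : arr td_quiver),
    [/\ cho (@td_step Z D l) q = Split a r N0 N1 N2,
        sval al = (TNode (inl a), TNode (inr q)),
        sval be = (TNode (inr q), TNode (inl r)) &
        arrows w = [:: al; be]].

Definition ar_ideal : forall a b : vtx td_quiver, kQ k a b -> Prop :=
  ideal ar_path.

Definition conley_morse_module (n : nat) : rep k td_quiver :=
  @Rep k td_quiver (fun x => homology R k n (node_pair (@td_step Z D) x))
    (fun al => homology_map R k n (td_lt_le (@td_good Z D) (svalP al).1)).

End TransitionDiagram.

(* Main.v *)
From HB Require Import structures.
From Stdlib Require List Eqdep.
From Stdlib Require Import Relations.
Require Import Defs.
From mathcomp Require Import all_boot all_order all_algebra.
From mathcomp Require Import all_classical all_reals topology.
From mathcomp.multinomials Require Import freeg.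

Set Implicit Arguments.
Unset Strict Implicit.
Unset Printing Implicit Defensive.

Import Order.TTheory GRing.Theory.

Local Open Scope classical_set_scope.
Local Open Scope ring_scope.

(** Time runs along a transition diagram: the steps of the filtration follow one
    another, and between two steps each block contributes a linear connecting
    sequence.  Every node has at most one incoming and one outgoing arrow on each
    side, past and future.  Both occur on the same side only at the coarse block
    q of an AR-split a -> q -> r, and there the composite is zero in homology:
    chains of N1 are relative boundaries of (N2, N1).  This is the relation that
    generates the ideal, and it has a second effect: a nonzero vector cannot be
    followed from a through q to r.  Whoever follows vectors along the diagram
    never turns back in time, so that the strings that occur are monotone paths
    in time and never close up to bands.

    Existence.  Bases of the homology of the nodes are obtained from Zorn's lemma
    and fitted to each other.  At a node, the images and preimages of 0 and of the
    whole spaces along the arrows from the past form a finite flag ([past_flag]),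
    because at an AR-split the image of i is contained in the
    kernel of j.  Going from the last time to the first, one chooses at every
    node a basis adapted to its flag, and such that each arrow sends each basis
    vector to zero or to a basis vector, never identifying two vectors that it
    does not kill ([monomial_bases]).  The point of the flags is that vectors of
    a future basis can be lifted to vectors which are as special with respect to
    the past as the ones they lift ([adapted_through]); hence no choice has to be
    revised.  Joining basis vectors that correspond to each other under an arrow,
    one gets components which are paths in time, and each of them spans a string
    submodule ([start_sum]).  The words of these submodules are strings since a
    path of arrows inside a word acts as nonzero, whereas the ideal acts as zero
    ([is_string_of_vectors]).

    Uniqueness.  A word is connected, so endomorphisms of its module are scalars.
    Comparing two decompositions, the scalars of the passages from one to the
    other between summands with the same word form two matrices which are inverse
    to each other, since a detour through a summand with another word contributes
    zero ([word_hom_same]).  Steinitz exchange for infinite families ([exchange])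
    turns each matrix into an injection that preserves words, and the argument of
    Cantor and Bernstein combines the two injections into a bijection. *)

(** * Bases of vector spaces of arbitrary dimension *)

Section Span.
Variables (k : fieldType) (V : lmodType k).
Implicit Types (A D E F G L W : set V) (x y e : V).

Inductive lspan A : V -> Prop :=
  | lspan0 : lspan A 0
  | lspanS c e x of A e & lspan A x : lspan A (c *: e + x).

Definition lsubspace W := W 0 /\ forall c x y, W x -> W y -> W (c *: x + y).

Lemma lspan_lsubspace A : lsubspace (lspan A).
Proof.
split=> [|c x y Ax Ay]; first exact: lspan0.
elim: Ax => [|d e z Ae _ IH]; first by rewrite scaler0 add0r.
by rewrite scalerDr scalerA -addrA; exact: lspanS.
Qed.

Lemma lsubspaceD W x y : lsubspace W -> W x -> W y -> W (x + y).
Proof. by move=> [_ sW] Wx Wy; rewrite -[x]scale1r; exact: sW. Qed.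

Lemma lsubspaceZ W c x : lsubspace W -> W x -> W (c *: x).
Proof. by move=> [W0 sW] Wx; rewrite -[_ *: _]addr0; exact: sW. Qed.

Lemma lsubspaceB W x y : lsubspace W -> W x -> W y -> W (x - y).
Proof. by move=> sW Wx /(lsubspaceZ (-1) sW); rewrite scaleN1r; exact: lsubspaceD. Qed.

Lemma lsubspaceI W L : lsubspace W -> lsubspace L -> lsubspace (W `&` L).
Proof.
by move=> [W0 WD] [L0 LD]; split=> // c x y [Wx Lx] [Wy Ly]; split; auto.
Qed.

Lemma lsubspace_sum W (I : Type) (r : seq I) (P : pred I) (f : I -> V) :
  lsubspace W -> (forall i, P i -> W (f i)) -> W (\sum_(i <- r | P i) f i).
Proof.
by move=> sW Wf; elim/big_ind: _ => // [|x y]; [case: sW|exact: lsubspaceD].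
Qed.

Lemma lspan_incl A : A `<=` lspan A.
Proof. by move=> x Ax; rewrite -[x]scale1r -[_ *: _]addr0; apply: lspanS => //; exact: lspan0. Qed.

Lemma lspan_min A W : lsubspace W -> A `<=` W -> lspan A `<=` W.
Proof. by move=> [W0 sW] AW x; elim=> // c e y /AW We _ Wy; exact: sW. Qed.

Lemma lspan_mono A D : A `<=` D -> lspan A `<=` lspan D.
Proof.
move=> AD; apply: lspan_min; first exact: lspan_lsubspace.
by move=> x /AD; exact: lspan_incl.
Qed.

Lemma lspanU A D x : lspan (A `|` D) x ->
  exists a b, [/\ lspan A a, lspan D b & x = a + b].
Proof.
elim=> [|c e y ADe _ [a [b [Aa Db ->]]]].
  by exists 0, 0; rewrite addr0; split=> //; exact: lspan0.
case: ADe => [Ae|De].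
  by exists (c *: e + a), b; rewrite addrA; split=> //; exact: lspanS.
by exists a, (c *: e + b); rewrite addrCA; split=> //; exact: lspanS.
Qed.

Lemma lspan_adjoin A e x : lspan (e |` A) x -> exists c, lspan A (x - c *: e).
Proof.
move=> /lspanU[a [b [ea Ab ->]]].
suff [c ->] : exists c, a = c *: e by exists c; rewrite addrC addKr.
elim: ea => [|c _ y -> _ [d ->]]; first by exists 0; rewrite scale0r.
by exists (c + d); rewrite scalerDl.
Qed.

Lemma lspan_sum A x : lspan A x ->
  exists s c, [/\ uniq s, {in s, forall e, A e} & x = \sum_(e <- s) c e *: e].
Proof.
elim=> [|d f y Af _ [s [c [us sA ->]]]].
  by exists [::], (fun=> 0); rewrite big_nil.
have [fs|fs] := boolP (f \in s).
  exists s, (fun e => c e + (if e == f then d else 0)); split=> //.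
  under [in RHS]eq_bigr do rewrite scalerDl.
  rewrite big_split addrC /=; congr (_ + _).
  rewrite (bigD1_seq f) //= eqxx big1_seq ?addr0 // => e /andP[/negPf-> _].
  by rewrite scale0r.
exists (f :: s), (fun e => if e == f then d else c e); split=> //=.
- by rewrite fs.
- by move=> e; rewrite inE => /predU1P[->//|/sA].
rewrite big_cons eqxx; congr (_ + _).
apply: eq_big_seq => e es; case: eqP => // ef.
by rewrite ef (negPf fs) in es.
Qed.

(** The vector e, having a nonzero coefficient, can be exchanged for x. *)
Lemma lspan_neq0 A x : lspan A x -> x != 0 ->
  exists e c, [/\ A e, c != 0 & lspan (A `\ e) (x - c *: e)].
Proof.
move=> /lspan_sum[s [c [us sA ->]]].
have [/allP s0|/allPn[e es ne]] := boolP (all (fun e => c e *: e == 0) s).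
  by rewrite big1_seq ?eqxx // => e /andP[_ /s0/eqP].
move=> _; exists e, (c e); split.
- exact: sA.
- by apply: contra_neq ne => ->; rewrite scale0r.
rewrite (bigD1_seq e) //= [_ - _]addrC addKr big_seq_cond.
apply: lsubspace_sum; first exact: lspan_lsubspace.
move=> f /andP[fs fe]; apply: lsubspaceZ; first exact: lspan_lsubspace.
by apply: lspan_incl; split; [exact: sA|move=> /= ef; rewrite ef eqxx in fe].
Qed.

Lemma lspan_cancel A x e c : c != 0 -> lspan A x -> lspan A (x - c *: e) -> lspan A e.
Proof.
move=> c0 Ax Axe; have -> : e = c^-1 *: (x - (x - c *: e)).
  by rewrite opprB addrC subrK scalerA mulVf // scale1r.
have sA := lspan_lsubspace A.
by apply: lsubspaceZ => //; exact: lsubspaceB.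
Qed.

Definition free_set E := forall e, E e -> ~ lspan (E `\ e) e.

Definition lin_basis W E := [/\ E `<=` W, free_set E & W `<=` lspan E].

Lemma free_subset E F : E `<=` F -> free_set F -> free_set E.
Proof.
move=> EF fF e /[dup] Ee /EF/fF; apply: contra_not; apply: lspan_mono.
exact: setSD.
Qed.

Lemma free_neq0 E e : free_set E -> E e -> e != 0.
Proof. by move=> fE /fE; apply: contra_notN => /eqP ->; exact: lspan0. Qed.

Lemma free_disjoint E A D x : free_set E -> A `<=` E -> D `<=` E ->
  A `&` D `<=` set0 -> lspan A x -> lspan D x -> x = 0.
Proof.
move=> fE AE DE AD Ax Dx; apply/eqP; apply: contraT => x0.
have [e [c [Ae c0 ec]]] := lspan_neq0 Ax x0.
case: (fE _ (AE _ Ae)); apply: (lspan_cancel c0 (x := x)).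
  apply: lspan_mono Dx => y Dy; split; first exact: DE.
  by move=> ye; apply: (AD e); split=> //; rewrite -ye.
by apply: lspan_mono ec => y [/AE].
Qed.

Lemma freeU G D : free_set G -> free_set D ->
  (forall x, lspan G x -> lspan D x -> x = 0) -> free_set (G `|` D).
Proof.
have main A B : free_set A -> (forall x, lspan A x -> lspan B x -> x = 0) ->
    forall e, A e -> ~ lspan ((A `|` B) `\ e) e.
  move=> fA AB e Ae sAB.
  have /lspanU[a [b [Aa Bb eab]]] : lspan ((A `\ e) `|` B) e.
    by apply: lspan_mono sAB => x [[Ax|Bx] xe]; [left|right].
  apply: (fA _ Ae).
  suff b0 : b = 0 by rewrite {2}eab b0 addr0.
  apply: AB => //; have -> : b = e - a by rewrite eab addrC addKr.
  apply: lsubspaceB; [exact: lspan_lsubspace|exact: lspan_incl|].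
  by apply: lspan_mono Aa => x [].
move=> fG fD GD e [Ge|De]; first exact: main.
by rewrite setUC; apply: main => // x Dx Gx; exact: GD.
Qed.

Lemma free_adjoin E x : free_set E -> ~ lspan E x -> free_set (x |` E).
Proof.
move=> fE nx e [->|Ee].
  by apply: contra_not nx; apply: lspan_mono => y [[yx|//] /(_ yx)].
move=> sE; have /lspan_adjoin[c] : lspan (x |` (E `\ e)) e.
  by apply: lspan_mono sE => y [[->|Ey] ye]; [left|right].
have [->|c0] := eqVneq c 0; first by rewrite scale0r subr0; exact: fE.
move=> ecx; apply: nx; apply: lspan_cancel c0 (lspan_incl Ee) _.
by apply: lspan_mono ecx => y [].
Qed.

(** A linear combination involves finitely many vectors, hence a single member of
    the chain; the set D allows one to leave out a vector. *)
Lemma lspan_chain D E (F : set (set V)) x : total_on F subset ->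
  lspan ((E `|` \bigcup_(A in F) A) `&` D) x ->
  lspan (E `&` D) x \/ exists2 A, F A & lspan ((E `|` A) `&` D) x.
Proof.
move=> tF; elim=> [|c e y [Ee De] _ IH]; first by left; exact: lspan0.
have step A : lspan ((E `|` A) `&` D) y -> A e ->
    lspan ((E `|` A) `&` D) (c *: e + y).
  by move=> ? ?; apply: lspanS => //; split=> //; right.
case: Ee IH => [Ee [Ey|[A FA Ay]]|[A FA Ae] [Ey|[B FB By]]].
- by left; apply: lspanS.
- by right; exists A => //; apply: lspanS => //; split=> //; left.
- right; exists A => //; apply: step => //; apply: lspan_mono Ey.
  by apply: setSI => ? ?; left.
have [AB|BA] := tF _ _ FA FB; right.
  by exists B => //; apply: step => //; exact: AB.
exists A => //; apply: step => //; apply: lspan_mono By; apply: setSI.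
exact: setUS.
Qed.

Lemma free_extend W E : free_set E -> E `<=` W ->
  exists2 E', E `<=` E' & lin_basis W E'.
Proof.
move=> fE EW; pose P A := A `<=` W /\ free_set (E `|` A).
have [F FP tF|A [[AW fA] maxA]] := @Zorn_bigcup _ P.
  split=> [x [A /FP[AW _]]|e Ee]; first exact: AW.
  move=> /lspan_chain => /(_ tF)[|[A FA sA]].
    case: Ee => [/fE //|[A FA Ae] sE].
    case: (FP A FA) => _ /(_ e (or_intror Ae)); apply.
    by apply: lspan_mono sE; apply: setSD => ? ?; left.
  case: Ee => [Ee|[B FB Be]].
    by case: (FP A FA) => _ /(_ e (or_introl Ee)).
  have [AB|BA] := tF _ _ FA FB.
    case: (FP B FB) => _ /(_ e (or_intror Be)); apply.
    by apply: lspan_mono sA; apply: setSD; exact: setUS.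
  by case: (FP A FA) => _ /(_ e (or_intror (BA _ Be))).
exists (E `|` A); first by move=> ? ?; left.
split=> //; first by move=> x [/EW|/AW].
move=> x Wx; apply: contrapT => nx; apply: (maxA (x |` A)).
  split=> [? ?|xA]; first by right.
  by apply: nx; apply: lspan_incl; right; apply: xA; left.
split; first by move=> y [->|/AW].
by rewrite setUCA; exact: free_adjoin.
Qed.

(** A finite chain of subspaces, listed from the largest to the smallest. *)
Fixpoint flag (s : seq (set V)) : Prop :=
  if s is L :: s' then
    [/\ lsubspace L, forall M, List.In M s' -> M `<=` L & flag s']
  else True.

Lemma flag_lsubspace s L : flag s -> List.In L s -> lsubspace L.
Proof. by elim: s => //= M s IH [sM _ /IH{}IH] [<-//|]. Qed.

(** For a basis E of W: the part of E in L spans all of the intersection. *)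
Definition adapted W E L := W `&` L `<=` lspan (E `&` L).

(** By induction on the flag, a basis of the part of W' in its largest member L is
    found first.  It remains independent when the given vectors outside of L are
    put back, since by adaptedness these are independent modulo L. *)
Lemma adapted_extend s : flag s -> forall W W' E,
  lsubspace W -> lsubspace W' -> W `<=` W' -> lin_basis W E ->
  (forall L, List.In L s -> adapted W E L) ->
  exists E', [/\ E `<=` E', lin_basis W' E' &
    forall L, List.In L s -> adapted W' E' L].
Proof.
elim: s => [_|L s IH [/= sL sub fs]] W W' E sW sW' WW' [EW fE WE] adE.
  have [|E' EE' bE'] := free_extend (W := W') fE; first exact: subset_trans WW'.
  by exists E'.
have spE D : D `<=` W -> lspan D `<=` W by exact: lspan_min.
have bEL : lin_basis (W `&` L) (E `&` L).
  split; first exact: setSI.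
    by apply: free_subset fE => x [].
  by apply: adE; left.
have [|||M Ms|G [EG [GW fG WG] adG]] :=
    IH fs (W `&` L) (W' `&` L) (E `&` L) _ _ _ bEL.
- exact: lsubspaceI.
- exact: lsubspaceI.
- exact: setSI.
- move=> x [[Wx Lx] Mx].
  apply: lspan_mono (adE _ (or_intror Ms) x (conj Wx Mx)) => y [Ey My].
  by split=> //; split=> //; exact: sub My.
have fEG : free_set (G `|` (E `\` L)).
  apply: freeU => // [|x Gx Ex]; first by apply: free_subset fE => x [].
  have Lx : L x.
    apply: lspan_min Gx => // y /GW[]//.
  have Wx : W x by apply: spE Ex => y [/EW].
  have ELx := adE _ (or_introl erefl) x (conj Wx Lx).
  apply: free_disjoint fE _ _ _ Ex ELx; [by move=> y []..|].
  by move=> y [[_ nLy] [_ /nLy]].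
have [|E' GE' bE'] := free_extend (W := W') fEG.
  by move=> x [/GW[]|[/EW/WW']].
exists E'; split=> //.
  move=> x Ex; apply: GE'; have [Lx|Lx] := pselect (L x).
    by left; exact: EG.
  by right.
move=> M [<-|Ms] x [W'x Mx].
  apply: lspan_mono (WG _ (conj W'x Mx)) => y Gy.
  by split; [apply: GE'; left|case: (GW _ Gy)].
apply: lspan_mono (adG _ Ms x (conj (conj W'x (sub _ Ms _ Mx)) Mx)) => y [Gy My].
by split=> //; apply: GE'; left.
Qed.

End Span.

Section LinearImages.
Variables (k : fieldType) (V W : lmodType k) (j : {linear V -> W}).

Lemma lsubspace_image L : lsubspace L -> lsubspace (j @` L).
Proof.
move=> [L0 sL]; split; first by exists 0 => //; rewrite linear0.
by move=> c _ _ [x Lx <-] [y Ly <-]; exists (c *: x + y); rewrite ?linearP //; exact: sL.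
Qed.

Lemma lsubspace_preimage L : lsubspace L -> lsubspace (j @^-1` L).
Proof.
by move=> [L0 sL]; split=> [|c x y Lx Ly] /=; rewrite ?linear0 // linearP; exact: sL.
Qed.

Lemma lspan_image A x : lspan A x -> lspan (j @` A) (j x).
Proof.
elim=> [|c e y Ae _ IH]; first by rewrite linear0; exact: lspan0.
by rewrite linearP; apply: lspanS => //; exists e.
Qed.

Lemma lspan_image_inv A y : lspan (j @` A) y -> exists2 x, lspan A x & y = j x.
Proof.
elim=> [|c _ z [e Ae <-] _ [x Ax ->]].
  by exists 0; rewrite ?linear0 //; exact: lspan0.
by exists (c *: e + x); rewrite ?linearP //; exact: lspanS.
Qed.

Lemma free_image D : free_set D ->
  (forall x, lspan D x -> j x = 0 -> x = 0) -> free_set (j @` D).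
Proof.
move=> fD kerD _ [e De <-] je; have [|x Dx ex] := @lspan_image_inv (D `\ e) (j e).
  by apply: lspan_mono je => _ [[f Df <-] fe]; exists f => //; split=> // fe0; apply: fe; rewrite fe0.
apply: (fD e De); suff exE : e = x by rewrite {2}exE.
apply/eqP; rewrite -subr_eq0; apply/eqP/kerD; last by rewrite linearB ex subrr.
apply: lsubspaceB; [exact: lspan_lsubspace|exact: lspan_incl|].
by apply: lspan_mono Dx => y [].
Qed.

Lemma free_image_ker D : set_inj D j -> free_set (j @` D) ->
  forall x, lspan D x -> j x = 0 -> x = 0.
Proof.
move=> injD fjD x Dx jx0; apply/eqP; apply: contraT => x0.
have [e [c [De c0 /lspan_image]]] := lspan_neq0 Dx x0.
rewrite linearB linearZ /= jx0 => ec.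
case: (fjD (j e)); first by exists e.
apply: (lspan_cancel c0 (x := 0)); first exact: lspan0.
apply: lspan_mono ec => _ [f [Df fe] <-]; split; first by exists f.
by move=> jfe; apply: fe; apply: injD; rewrite ?inE.
Qed.

Lemma free_of_image D : set_inj D j -> free_set (j @` D) -> free_set D.
Proof.
move=> injD fjD e De /lspan_image; apply: contra_not (fjD (j e) _); last by exists e.
apply: lspan_mono => _ [f [Df fe] <-]; split; first by exists f.
by move=> jfe; apply: fe; apply: injD; rewrite ?inE.
Qed.

End LinearImages.

(** * Monomial bases of a representation *)

(** The matrix of phi in the bases E and F has entries 0 and 1, with at most one
    entry 1 in each row and each column. *)
Definition monomial (k : fieldType) (V W : lmodType k) (phi : V -> W)
    (E : set V) (F : set W) : Prop :=
  (forall e, E e -> phi e = 0 \/ F (phi e)) /\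
  (forall e e', E e -> E e' -> phi e = phi e' -> phi e <> 0 -> e = e').

Section LocalStep.
Variables (k : fieldType) (V : lmodType k).

(** The least member of the flag whose image contains e provides the preimage. *)
Lemma flag_lift (R : lmodType k) (j : {linear V -> R}) s e :
  flag s -> range j e ->
  exists2 x, j x = e & forall L, List.In L s -> (j @` L) e -> L x.
Proof.
move=> fs [x0 _ x0e]; elim: s fs => [_|L s IH [sL sub /IH[x xe xs]]].
  by exists x0.
have [[M [Ms Me]]|nM] := pselect (exists M, List.In M s /\ (j @` M) e).
  exists x => // M' [<-|M's] M'e; last exact: xs.
  by apply: (sub _ Ms); exact: xs.
have [[y Ly ye]|nL] := pselect ((j @` L) e).
  by exists y => // M' [<-|M's] M'e //; case: nM; exists M'.
by exists x0 => // M' [<-|M's] M'e //; case: nM; exists M'.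
Qed.

(** Here A and R are the neighbours of V in the future, and the flag s comes from
    the past.  The images of the basis vectors of A are completed to an adapted
    basis of the kernel of j; lifts of the basis vectors of R in the image of j
    are added to it.  Each lift lies in every member of the flag where a lift
    exists, and this keeps the whole basis adapted. *)
Lemma adapted_through (A R : lmodType k) (i : {linear A -> V})
    (j : {linear V -> R}) (s : seq (set V)) (EA : set A) (ER : set R) :
  flag s -> List.In [set 0] s -> (forall a, j (i a) = 0) ->
  lin_basis [set: A] EA -> (forall L, List.In L s -> adapted [set: A] EA (i @^-1` L)) ->
  lin_basis [set: R] ER -> List.In setT s ->
  (forall L, List.In L s -> adapted [set: R] ER (j @` L)) ->
  exists E, [/\ lin_basis [set: V] E, forall L, List.In L s -> adapted [set: V] E L,
    monomial i EA E & monomial j E ER].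
Proof.
move=> fs s0 ji0 [_ fA sA] aA [_ fR sR] sT aR.
have fsub L : List.In L s -> lsubspace L by exact: (flag_lsubspace fs).
pose D := EA `&` [set a | i a != 0].
have fD : free_set D by apply: free_subset fA => a [].
(* EA is adapted to the kernel of i, so D is independent modulo that kernel. *)
have kerD a : lspan D a -> i a = 0 -> a = 0.
  move=> Da ia; apply: free_disjoint fA _ _ _ Da (aA _ s0 a _) => //.
  - by move=> y [].
  - by move=> y [[_ /= /eqP iy] [_ /= /iy]].
have sD L a : List.In L s -> L (i a) -> lspan (i @` D `&` L) (i a).
  move=> Ls La.
  have : lspan (EA `&` i @^-1` L) a by apply: aA.
  elim=> [|c e x [EAe Le] _ IH]; first by rewrite linear0; exact: lspan0.
  rewrite linearP; have [->|ie] := eqVneq (i e) 0; first by rewrite scaler0 add0r.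
  by apply: lspanS => //; split=> //; exists e.
have sR0 : lsubspace (range i) by apply: lsubspace_image.
have sK : lsubspace (j @^-1` [set 0]).
  apply: lsubspace_preimage; split=> // c x y -> ->.
  by rewrite scaler0 addr0.
have iK : range i `<=` j @^-1` [set 0] by move=> _ [a _ <-] /=; exact: ji0.
have bI : lin_basis (range i) (i @` D).
  split.
  - by move=> _ [a _ <-]; exists a.
  - exact: free_image.
  - by move=> _ [a _ <-]; apply: lspan_mono (sD _ a sT I) => y [].
have aI L : List.In L s -> adapted (range i) (i @` D) L.
  by move=> Ls _ [[a _ <-] La]; exact: sD.
have [K [IK [KK fK sKK] aK]] := adapted_extend fs sR0 sK iK bI aI.
have /choice[l lP] : forall e : R, exists x, range j e ->
    j x = e /\ forall L, List.In L s -> (j @` L) e -> L x.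
  move=> e; have [je|nje] := pselect (range j e); last by exists 0.
  by have [x ? ?] := flag_lift fs je; exists x.
pose ER' := ER `&` range j.
have fR' : free_set ER' by apply: free_subset fR => x [].
have jl : j @` (l @` ER') = ER'.
  apply/seteqP; split => [_ [_ [e [Ee je] <-] <-]|e [Ee je]].
    by rewrite (lP _ je).1.
  by exists (l e); [exists e|rewrite (lP _ je).1].
have injl : set_inj (l @` ER') j.
  move=> x y; rewrite !inE => -[e [_ je] <-] [e' [_ je'] <-].
  by rewrite (lP _ je).1 (lP _ je').1 => ->.
have fl : free_set (l @` ER') by apply: free_of_image injl _; rewrite jl.
have kerl x : lspan (l @` ER') x -> j x = 0 -> x = 0.
  by apply: free_image_ker injl _ x; rewrite jl.
have jK x : lspan K x -> j x = 0 by move=> /(lspan_min sK KK).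
have adE L : List.In L s -> adapted [set: V] (K `|` l @` ER') L.
  move=> Ls x [_ Lx].
  have [y Ly jxy] : exists2 y, lspan (l @` ER' `&` L) y & j x = j y.
    have : lspan (ER `&` j @` L) (j x) by apply: aR => //; split=> //; exists x.
    elim=> [|c e z [ERe Le] _ [y Ly zy]].
      by exists 0; rewrite ?linear0 //; exact: lspan0.
    have je : range j e by case: Le => a _ <-; exists a.
    exists (c *: l e + y); last by rewrite linearP (lP _ je).1 zy.
    apply: lspanS => //; split; last exact: (lP _ je).2.
    by exists e.
  rewrite -[x](subrK y); apply: lsubspaceD; first exact: lspan_lsubspace.
    have : lspan (K `&` L) (x - y).
      apply: aK => //; split; first by rewrite /= linearB jxy subrr.
      apply: lsubspaceB => //; first exact: fsub.
      by apply: lspan_min Ly; [exact: fsub|move=> z []].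
    by apply: lspan_mono => z [Kz Lz]; split=> //; left.
  by apply: lspan_mono Ly => z [Kz Lz]; split=> //; right.
exists (K `|` l @` ER'); split=> //.
- split=> //.
    by apply: freeU => // x /jK jx lx; exact: kerl.
  by move=> x _; apply: lspan_mono (adE _ sT x (conj I I)) => y [].
- split=> [e EAe|e e' EAe EAe' ee ne].
    have [ie|ie] := eqVneq (i e) 0; first by left.
    by right; left; apply: IK; exists e.
  apply/eqP; rewrite -subr_eq0; apply/eqP; apply: kerD; last first.
    by rewrite linearB ee subrr.
  apply: lsubspaceB; first exact: lspan_lsubspace.
    by apply: lspan_incl; split=> //; apply/eqP.
  by apply: lspan_incl; split=> //; rewrite /= -ee; apply/eqP.
- split=> [e [/KK|[f [ERf jf] <-]]|e e' Ee Ee' ee ne]; first by left.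
    by rewrite (lP _ jf).1; right.
  case: Ee ne ee => [/KK //|le ne ee].
  case: Ee' ee => [/KK je'|le' ee]; first by rewrite je' in ne *.
  by apply: injl; rewrite ?inE.
Qed.

End LocalStep.

Section RelationQuiver.
Variables (k : fieldType) (N : Type) (arrow : N -> N -> Prop).

(** In the quiver of a relation the ends of an arrow determine it, and they are
    available up to conversion, so that no transport between the spaces of equal
    vertices is called for. *)
Definition rel_quiver : quiver :=
  @Quiver N {xy : N * N | arrow xy.1 xy.2}
    (fun al => (sval al).1) (fun al => (sval al).2).

Definition mkarr x y (h : arrow x y) : arr rel_quiver :=
  exist (fun xy : N * N => arrow xy.1 xy.2) (x, y) h.

Variables (M : rep k rel_quiver) (time_of : N -> nat).

Definition amap x y (h : arrow x y) : {linear rsp M x -> rsp M y} :=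
  rmap M (mkarr h).

Lemma amap_irr x y (h h' : arrow x y) : amap h = amap h'.
Proof. by rewrite (Prop_irrelevance h h'). Qed.

(** Locally, the time makes the quiver look like a line on either side of each
    vertex, except where an arrow from one side is followed by an arrow back to
    the same side; the last two conditions say that M does not see such a turn. *)
Record timed : Prop := Timed {
  time_neq : forall x y, arrow x y -> time_of x <> time_of y;
  past_in : forall x x' y, arrow x y -> arrow x' y ->
    (time_of x < time_of y)%N -> (time_of x' < time_of y)%N -> x = x';
  future_in : forall x x' y, arrow x y -> arrow x' y ->
    (time_of y < time_of x)%N -> (time_of y < time_of x')%N -> x = x';
  past_out : forall x y y', arrow x y -> arrow x y' ->
    (time_of y < time_of x)%N -> (time_of y' < time_of x)%N -> y = y';
  future_out : forall x y y', arrow x y -> arrow x y' ->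
    (time_of x < time_of y)%N -> (time_of x < time_of y')%N -> y = y';
  past_zero : forall x y z (h : arrow x y) (h' : arrow y z) m,
    (time_of x < time_of y)%N -> (time_of z < time_of y)%N -> amap h' (amap h m) = 0;
  future_zero : forall x y z (h : arrow x y) (h' : arrow y z) m,
    (time_of y < time_of x)%N -> (time_of y < time_of z)%N -> amap h' (amap h m) = 0 }.

Hypothesis timedM : timed.

(** The subspaces of a vertex that its past determines.  The vectors in them are
    those that extend to the past in a prescribed manner. *)
Inductive past_space : forall v, set (rsp M v) -> Prop :=
  | past0 v : past_space ([set 0] : set (rsp M v))
  | pastT v : past_space [set: rsp M v]
  | past_image x y (h : arrow x y) U of (time_of x < time_of y)%N & past_space U :
      past_space (amap h @` U)
  | past_preimage x y (h : arrow x y) U of (time_of y < time_of x)%N & past_space U :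
      past_space (amap h @^-1` U).

Lemma past_spaceE v (U : set (rsp M v)) : past_space U ->
  [\/ U = [set 0], U = setT,
    exists x, exists (h : arrow x v), (time_of x < time_of v)%N /\
      exists2 U', past_space U' & U = amap h @` U' |
    exists y, exists (h : arrow v y), (time_of y < time_of v)%N /\
      exists2 U', past_space U' & U = amap h @^-1` U'].
Proof.
case=> [w|w|x y h U' xy pU|x y h U' xy pU].
- exact: Or41.
- exact: Or42.
- by apply: Or43; exists x, h; split=> //; exists U'.
- by apply: Or44; exists y, h; split=> //; exists U'.
Qed.

Lemma In_cat T (x : T) s t : List.In x (s ++ t) <-> List.In x s \/ List.In x t.
Proof. by elim: s => /= [|y s ->]; tauto. Qed.

Lemma In_map T S (f : T -> S) s y :
  List.In y (map f s) <-> exists2 x, y = f x & List.In x s.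
Proof.
elim: s => /= [|x s ->]; first by split=> // -[].
split=> [[<-|[z -> zs]]|[z -> [->|zs]]]; first by exists x => //; left.
- by exists z => //; right.
- by left.
- by right; exists z.
Qed.

Lemma flag_cat (V : lmodType k) (s t : seq (set V)) : flag s -> flag t ->
  (forall L K, List.In L s -> List.In K t -> K `<=` L) -> flag (s ++ t).
Proof.
move=> + ft; elim: s => //= L s IH [sL sub fs] st; split=> //.
  by move=> K /In_cat[Ks|Kt]; [exact: sub|apply: (st L K) => //; left].
by apply: IH => // L' K L's Kt; apply: (st L' K) => //; right.
Qed.

Lemma flag_map (V W : lmodType k) (f : set V -> set W) s : flag s ->
  {homo f : A B / A `<=` B} -> (forall A, lsubspace A -> lsubspace (f A)) ->
  flag (map f s).
Proof.
move=> fs mf sf; elim: s fs => //= L s IH [sL sub fs].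
split; [exact: sf| |exact: IH].
by move=> _ /In_map[K -> Ks]; apply: mf; exact: sub.
Qed.

(** An arrow from the past has its image in the kernel of the arrow to the past.
    So the images of one flag lie below the preimages of another, and they
    concatenate to a flag. *)
Lemma past_flag v : exists s : seq (set (rsp M v)),
  flag s /\ forall U, List.In U s <-> past_space U.
Proof.
move: {2}(time_of v).+1 (ltnSn (time_of v)) => n.
elim: n v => // n IH v; rewrite ltnS => vn.
have [s1 [fs1 s1P s1K]] : exists s1 : seq (set (rsp M v)), [/\ flag s1,
    forall U, List.In U s1 <-> exists x, exists (h : arrow x v),
      (time_of x < time_of v)%N /\ exists2 U', past_space U' & U = amap h @` U' &
    forall U, List.In U s1 -> forall y (h : arrow v y), (time_of y < time_of v)%N ->
      U `<=` amap h @^-1` [set 0]].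
  have [[x [h xv]]|nx] :=
    pselect (exists x, exists (h : arrow x v), (time_of x < time_of v)%N).
    have [s [fs sP]] := IH x (leq_trans xv vn).
    exists (map (fun U => amap h @` U) s); split.
    - apply: flag_map fs _ _ => [A B|A]; [exact: image_subset|exact: lsubspace_image].
    - move=> U; split=> [/In_map[U' -> /sP pU']|].
        by exists x, h; split=> //; exists U'.
      move=> [x' [h' [x'v [U' pU' ->]]]].
      have xx' := past_in timedM h' h x'v xv.
      move: xx' h' U' {x'v} pU' => -> h' U' pU'.
      by rewrite (amap_irr h' h); apply/In_map; exists U' => //; apply/sP.
    - move=> _ /In_map[U' -> _] y h' yv _ [m _ <-] /=.
      exact: (past_zero timedM).
  exists [::]; split=> // U; split=> //= -[x [h [xv _]]].
  by case: nx; exists x, h.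
have [s2 [fs2 s2P s2K]] : exists s2 : seq (set (rsp M v)), [/\ flag s2,
    forall U, List.In U s2 <-> exists y, exists (h : arrow v y),
      (time_of y < time_of v)%N /\ exists2 U', past_space U' & U = amap h @^-1` U' &
    forall U, List.In U s2 -> exists y, exists2 h : arrow v y, (time_of y < time_of v)%N &
      amap h @^-1` [set 0] `<=` U].
  have [[y [h yv]]|ny] :=
    pselect (exists y, exists (h : arrow v y), (time_of y < time_of v)%N).
    have [s [fs sP]] := IH y (leq_trans yv vn).
    exists (map (fun U => amap h @^-1` U) s); split.
    - by apply: flag_map fs _ _ => [A B AB m /AB|A] //; exact: lsubspace_preimage.
    - move=> U; split=> [/In_map[U' -> /sP pU']|].
        by exists y, h; split=> //; exists U'.
      move=> [y' [h' [y'v [U' pU' ->]]]].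
      have yy' := past_out timedM h' h y'v yv.
      move: yy' h' U' {y'v} pU' => -> h' U' pU'.
      by rewrite (amap_irr h' h); apply/In_map; exists U' => //; apply/sP.
    - move=> _ /In_map[U' -> U's]; exists y, h => // m /= ->.
      by case: (flag_lsubspace fs U's).
  exists [::]; split=> // U; split=> //= -[y [h [yv _]]].
  by case: ny; exists y, h.
have sp0 : lsubspace ([set 0] : set (rsp M v)).
  by split=> // c x y -> ->; rewrite scaler0 addr0.
exists (setT :: (s2 ++ s1) ++ [:: [set 0]]); split; last first.
  move=> U; split=> [/=[<-|]|/past_spaceE]; first exact: pastT.
    move=> /In_cat[/In_cat[]|[<-|//]]; last exact: past0.
      by move=> /s2P[y [h [yv [U' pU' ->]]]]; exact: past_preimage.
    by move=> /s1P[y [h [yv [U' pU' ->]]]]; exact: past_image.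
  case=> [->|->|/s1P Us|/s2P Us]; [right|by left|right|right].
  - by apply/In_cat; right; left.
  - by apply/In_cat; left; apply/In_cat; right.
  - by apply/In_cat; left; apply/In_cat; left.
have fs21 : flag (s2 ++ s1).
  apply: flag_cat => // L K /s2K[y [h yv hL]] /s1K/(_ y h yv) hK.
  exact: subset_trans hL.
split=> //; apply: flag_cat => // L K Ls [<-|//] _ ->.
by case: (flag_lsubspace fs21 Ls).
Qed.

Definition past_adapted v (E : set (rsp M v)) : Prop :=
  lin_basis setT E /\ forall U, past_space U -> adapted setT E U.

Definition future_monomial v (E : set (rsp M v)) (F : forall w, set (rsp M w)) :=
  (forall w (h : arrow w v), (time_of v < time_of w)%N -> monomial (amap h) (F w) E) /\
  (forall w (h : arrow v w), (time_of v < time_of w)%N -> monomial (amap h) E (F w)).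

Lemma empty_basis : lin_basis [set: 'rV[k]_0] set0.
Proof.
split=> // x _; have -> : x = 0 by apply/rowP; case.
exact: lspan0.
Qed.

Lemma empty_adapted U : adapted [set: 'rV[k]_0] set0 U.
Proof.
move=> x _; have -> : x = 0 by apply/rowP; case.
exact: lspan0.
Qed.

(** A missing neighbour in the future is replaced by the zero space. *)
Lemma past_adapted_step v (F : forall w, set (rsp M w)) :
  (forall w, (time_of v < time_of w)%N -> past_adapted (F w)) ->
  exists E : set (rsp M v), past_adapted E /\ future_monomial E F.
Proof.
move=> FP; have [s [fs sP]] := past_flag v.
have [A [i [EA [bA aA mA zA]]]] : exists (A : lmodType k)
    (i : {linear A -> rsp M v}) (EA : set A), [/\ lin_basis setT EA,
    forall L, List.In L s -> adapted setT EA (i @^-1` L),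
    forall E, monomial i EA E ->
      forall w (h : arrow w v), (time_of v < time_of w)%N -> monomial (amap h) (F w) E &
    forall r (h : arrow v r), (time_of v < time_of r)%N -> forall a, amap h (i a) = 0].
  have [[w [h vw]]|nw] :=
    pselect (exists w, exists (h : arrow w v), (time_of v < time_of w)%N).
    exists (rsp M w), (amap h), (F w); have [bF aF] := FP _ vw; split=> //.
    - by move=> L /sP pL; apply: aF; exact: past_preimage.
    - move=> E mE w' h' vw'; have ww' := future_in timedM h' h vw' vw.
      by move: ww' h' {vw'} => -> h'; rewrite (amap_irr h' h).
    - by move=> r h' vr a; exact: (future_zero timedM).
  exists 'rV[k]_0, \0, set0; split.
  - exact: empty_basis.
  - by move=> L _; exact: empty_adapted.
  - by move=> E _ w h vw; case: nw; exists w, h.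
  - by move=> r h _ a; rewrite linear0.
have [R [j [ER [bR aR mR ji0]]]] : exists (R : lmodType k)
    (j : {linear rsp M v -> R}) (ER : set R), [/\ lin_basis setT ER,
    forall L, List.In L s -> adapted setT ER (j @` L),
    forall E, monomial j E ER ->
      forall w (h : arrow v w), (time_of v < time_of w)%N -> monomial (amap h) E (F w) &
    forall a, j (i a) = 0].
  have [[w [h vw]]|nw] :=
    pselect (exists w, exists (h : arrow v w), (time_of v < time_of w)%N).
    exists (rsp M w), (amap h), (F w); have [bF aF] := FP _ vw; split=> //.
    - by move=> L /sP pL; apply: aF; exact: past_image.
    - move=> E mE w' h' vw'; have ww' := future_out timedM h' h vw' vw.
      by move: ww' h' {vw'} => -> h'; rewrite (amap_irr h' h).
    - exact: zA.
  exists 'rV[k]_0, \0, set0; split=> //.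
  - exact: empty_basis.
  - by move=> L _; exact: empty_adapted.
  - by move=> E _ w h vw; case: nw; exists w, h.
have [||E [bE aE iE jE]] := adapted_through fs _ ji0 bA aA bR _ aR.
- by apply/sP; exact: past0.
- by apply/sP; exact: pastT.
exists E; split; first by split=> // U /sP; exact: aE.
by split; [exact: mA|exact: mR].
Qed.

(** The flag of a vertex depends on its past only, and the condition on the arrows
    to be satisfied there on its future only; so choosing bases from the last time
    to the first never calls for a revision. *)
Lemma monomial_bases n : (forall v, (time_of v < n)%N) ->
  exists F : forall v, set (rsp M v),
    forall v, past_adapted (F v) /\ future_monomial (F v) F.
Proof.
move=> time_bound.
(* The last m times are dealt with. *)
suff : forall m, exists F : forall v, set (rsp M v), forall v,
    (n <= time_of v + m)%N -> past_adapted (F v) /\ future_monomial (F v) F.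
  by move=> /(_ n)[F FP]; exists F => v; apply: FP; exact: leq_addl.
elim=> [|m [F FP]].
  exists (fun=> set0) => v; rewrite addn0 leqNgt time_bound //.
have step v : exists E : set (rsp M v), time_of v + m.+1 = n ->
    past_adapted E /\ future_monomial E F.
  have [vn|vn] := eqVneq (time_of v + m.+1)%N n; last first.
    by exists set0 => /eqP; rewrite (negPf vn).
  have [|E EP] := @past_adapted_step v F; last by exists E.
  move=> w vw; apply: (FP w _).1; rewrite -vn addnS -addSn leq_add2r //.
pose G v := if (time_of v + m.+1 == n)%N then sval (cid (step v)) else F v.
have GF w : (n <= time_of w + m)%N -> G w = F w.
  by rewrite /G => nw; rewrite addnS gtn_eqF // ltnS.
exists G => v; rewrite leq_eqVlt => /predU1P[nv|nv]; last first.
  have nv' : (n <= time_of v + m)%N by rewrite -ltnS -addnS.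
  rewrite (GF _ nv'); have [aF [mF1 mF2]] := FP _ nv'; split=> //.
  by split=> w h vw; rewrite GF; auto; apply: leq_trans nv' _; rewrite leq_add2r ltnW.
have [aE [mE1 mE2]] := svalP (cid (step v)) (esym nv).
have GE : G v = sval (cid (step v)) by rewrite /G; case: eqP => // /(_ (esym nv)).
rewrite GE; split=> //; split=> w h vw; rewrite GF; auto; by rewrite nv addnS -addSn leq_add2r.
Qed.

Lemma monomial_arrow (F : forall v, set (rsp M v)) :
  (forall v, future_monomial (F v) F) ->
  forall x y (h : arrow x y), monomial (amap h) (F x) (F y).
Proof.
move=> FP x y h; case: (ltngtP (time_of x) (time_of y)) => [xy|yx|/(time_neq timedM h)//].
  by have [_] := FP x; apply.
by have [mF _] := FP y; exact: mF.
Qed.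

End RelationQuiver.

(** * Direct sums of string modules from bases *)

Section RowSum.
Variable k : fieldType.

(** The spaces of a string module are rows of length 0 or 1: the sum of the entries
    is the coordinate of a vector, with no distinction of the two cases. *)
Definition row_sum d (r : 'rV[k]_d) : k := \sum_i r 0 i.

Fact row_sum_linear d : scalar (@row_sum d).
Proof.
move=> a x y; rewrite /row_sum mulr_sumr -big_split /=.
by apply: eq_bigr => i _; rewrite !mxE.
Qed.

HB.instance Definition _ d :=
  GRing.isLinear.Build k 'rV[k]_d k *%R (@row_sum d) (@row_sum_linear d).

Lemma row_sum_inj (b : bool) (r : 'rV[k]_b) : row_sum r = 0 -> r = 0.
Proof.
case: b r => r; last by move=> _; apply/rowP; case.
rewrite /row_sum big_ord1 => r0; apply/rowP => i.
by rewrite (ord1 i) r0 mxE.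
Qed.

Lemma row_sum_const (b : bool) c : b -> row_sum (const_mx c : 'rV[k]_b) = c.
Proof. by case: b => // _; rewrite /row_sum big_ord1 mxE. Qed.

Lemma row_sum_mul_const d (b : bool) (r : 'rV[k]_d) : b ->
  row_sum (r *m (const_mx 1 : 'M[k]_(d, b))) = row_sum r.
Proof.
case: b => // _; rewrite /row_sum big_ord1 mxE.
by apply: eq_bigr => i _; rewrite mxE mulr1.
Qed.

Variable V : lmodType k.

Definition row_span d (x : V) (r : 'rV[k]_d) : V := row_sum r *: x.

Fact row_span_linear d x : linear (@row_span d x).
Proof. by move=> a r s; rewrite /row_span linearP scalerDl scalerA. Qed.

HB.instance Definition _ d x :=
  GRing.isLinear.Build k 'rV[k]_d V *:%R (@row_span d x) (@row_span_linear d x).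

End RowSum.

Lemma fsum_seq (V : zmodType) (J : choiceType) (r : seq J) (F : J -> V) :
  uniq r -> (forall j, j \notin r -> F j = 0) ->
  \sum_(j \in [set: J]) F j = \sum_(j <- r) F j.
Proof.
move=> ur Fr; rewrite (fsbigE r) // => [|j _]; last exact: Fr.
by apply: eq_bigl => j; rewrite in_setT.
Qed.

Lemma finite_cover (J : choiceType) (A : set J) : finite_set A ->
  exists2 r : seq J, uniq r & forall j, j \notin r -> ~ A j.
Proof.
move=> /finite_seqP[s ->]; exists (undup s); first exact: undup_uniq.
by move=> j; rewrite mem_undup => /negP.
Qed.

Section StringSum.
Variables (k : fieldType) (Q : quiver) (M : rep k Q).
Variables (J : choiceType) (u : J -> qword Q).
Variable b : forall (j : J) (a : vtx Q), rsp M a.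

Hypothesis b_arr : forall j al, through_arr (u j) al ->
  [/\ through_vtx (u j) (src al), through_vtx (u j) (tgt al) &
      rmap M al (b j (src al)) = b j (tgt al)].
Hypothesis b_end : forall j al, through_vtx (u j) (src al) ->
  ~ through_arr (u j) al -> rmap M al (b j (src al)) = 0.
Hypothesis b_span : forall a v,
  lspan [set b j a | j in [set j | through_vtx (u j) a]] v.
Hypothesis b_free : forall a j, through_vtx (u j) a ->
  ~ lspan [set b j' a | j' in [set j' | through_vtx (u j') a /\ j' <> j]] (b j a).

Definition string_incl (j : J) (a : vtx Q) :
    {linear rsp (string_module k (u j)) a -> rsp M a} :=
  @row_span k (rsp M a) (string_dim (u j) a) (b j a).

Lemma string_dim_out (w : qword Q) a (v : 'rV[k]_(string_dim w a)) : ~ through_vtx w a -> v = 0.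
Proof.
move=> nwa; have d0 : string_dim w a = 0%N by rewrite /string_dim asboolF.
by apply/rowP => i; have := ltn_ord i; rewrite {2}d0.
Qed.

Lemma string_incl_hom j : is_rep_hom (string_incl j).
Proof.
move=> al v; rewrite /string_incl /= /row_span /mulmxr linearZ /=.
rewrite /string_mx; case: asboolP => [t|nt].
  have [_ /asboolP tt ->] := b_arr t.
  by rewrite row_sum_mul_const.
rewrite mulmx0 raddf0 scale0r.
have [ts|ns] := pselect (through_vtx (u j) (src al)).
  by rewrite (b_end ts nt) scaler0.
by rewrite (string_dim_out v ns) raddf0 scale0r.
Qed.

(** At each vertex, the vectors of the words through it form a basis; coordinates
    in this basis are the components in the string modules. *)
Lemma string_sum : is_direct_sum (N := fun j => string_module k (u j)) string_incl.
Proof.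
split=> [|a v]; first exact: string_incl_hom.
have [x [fx vx]] : exists x : forall j, rsp (string_module k (u j)) a,
    finite_set [set j | x j <> 0] /\
    v = \sum_(j \in [set: J]) string_incl j a (x j).
  elim: (b_span v) => [|c _ w [j tj <-] _ [x [fx ->]]].
    exists (fun=> 0); split; first by rewrite (_ : mkset _ = set0) // -subset0 => j.
    by rewrite fsbig1 // => j _; rewrite linear0.
  pose y i := x i + (if i == j then const_mx c else 0 : 'rV_(string_dim (u i) a)).
  have [r ur xr] := finite_cover fx.
  have xr0 i : i \notin r -> x i = 0 by move=> /xr /contrapT.
  exists y; split.
    apply: (sub_finite_set (B := [set` j :: r])); last exact: finite_seq.
    move=> i /= nyi; apply: contrapT => /negP; rewrite inE negb_or => /andP[ij ir].
    by apply: nyi; rewrite /y (negPf ij) addr0 xr0.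
  pose r' := j :: rem j r.
  have ur' : uniq r' by rewrite /= rem_uniq // andbT mem_rem_uniqF.
  have rr' i : i \notin r' -> i \notin r /\ i != j.
    rewrite inE negb_or => /andP[ij]; rewrite mem_rem_uniq // inE /= ij /=.
    by move=> ->.
  rewrite !(@fsum_seq _ _ r') //; last 2 first.
  - by move=> i /rr'[ir ij]; rewrite /y (negPf ij) addr0 xr0 // linear0.
  - by move=> i /rr'[ir ij]; rewrite xr0 // linear0.
  rewrite /r' !big_cons addrA /y eqxx raddfD /= [X in _ = X + _]addrC; congr (_ + _ + _).
    by rewrite /row_span row_sum_const //; apply/asboolP.
  apply: eq_big_seq => i; rewrite mem_rem_uniq // inE => /andP[/negPf -> _].
  by rewrite addr0.
exists x; split=> // y [fy vy]; apply: functional_extensionality_dep => j.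
apply/eqP; apply: contraT => xyj.
have [r ur xyr] : exists2 r : seq J, uniq r &
    forall j, j \notin r -> x j = 0 /\ y j = 0.
  have /finite_cover[r ur xyr] : finite_set ([set i | x i <> 0] `|` [set i | y i <> 0]).
    by rewrite finite_setU.
  exists r => // i /xyr /not_orP[/contrapT ? /contrapT ?]; by split.
have {}vy : \sum_(i <- r) string_incl i a (x i - y i) = 0.
  under eq_bigr do rewrite raddfB.
  rewrite sumrB -!(@fsum_seq _ _ r) //; first by rewrite -vx -vy subrr.
    by move=> i /xyr[xi yi]; rewrite ?xi ?yi; exact: linear0.
  by move=> i /xyr[xi yi]; rewrite ?xi ?yi; exact: linear0.
have jr : j \in r by apply: contraNT xyj => /xyr[-> ->].
have dj : row_sum (x j - y j) != 0.
  apply: contra_neq xyj => /row_sum_inj /eqP; rewrite subr_eq0.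
  by move=> /eqP.
have thr i (z : rsp (string_module k (u i)) a) : z <> 0 -> through_vtx (u i) a.
  by move=> nz; apply: contrapT => /(string_dim_out z).
case: (b_free (a := a) (j := j)).
  by apply: (thr _ (x j - y j)) => /eqP; rewrite subr_eq0; exact/negP.
apply: (lspan_cancel dj (lspan0 _)); rewrite sub0r.
move: vy; rewrite (bigD1_seq j) //= {1}/row_span => /eqP.
rewrite addr_eq0 => /eqP ->; rewrite opprK big_seq_cond.
apply: lsubspace_sum; first exact: lspan_lsubspace.
move=> i /andP[_ ij]; have [ti|ni] := pselect (through_vtx (u i) a).
  apply: lsubspaceZ; first exact: lspan_lsubspace.
  by apply: lspan_incl; exists i => //; split=> //; exact/eqP.
by rewrite (string_dim_out (x i - y i) ni) raddf0; exact: lspan0.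
Qed.

End StringSum.

(** * Strings from monomial bases *)

Section Strings.
Variables (k : fieldType) (N : Type) (arrow : N -> N -> Prop).
Variables (M : rep k (rel_quiver arrow)) (time_of : N -> nat) (n : nat).
Hypothesis timedM : timed M time_of.
Hypothesis time_bound : forall v, (time_of v < n)%N.
Variable F : forall v, set (rsp M v).
Hypothesis F_basis : forall v, lin_basis setT (@F v).
Hypothesis F_monomial :
  forall x y (h : arrow x y), monomial (amap M h) (@F x) (@F y).

Local Notation Q := (rel_quiver arrow).

Definition elt := {v : N & rsp M v}.

(** The letter records the arrow that joins p to q, and whether that arrow goes
    along with time. *)
Definition link (p q : elt) (l : letter Q) : Prop :=
  [/\ F (projT2 p), F (projT2 q), (time_of (projT1 p) < time_of (projT1 q))%N &
    (exists2 h : arrow (projT1 p) (projT1 q),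
       amap M h (projT2 p) = projT2 q & l = (mkarr h, true)) \/
    (exists2 h : arrow (projT1 q) (projT1 p),
       amap M h (projT2 q) = projT2 p & l = (mkarr h, false))].

Lemma F_neq0 v (e : rsp M v) : F e -> e <> 0.
Proof. by case: (F_basis v) => _ fF _ /(free_neq0 fF)/eqP. Qed.

(** There is only one arrow to the future and one from the future, and neither of
    them merges basis vectors.  A basis vector cannot be linked by both, since
    their composite is zero. *)
Lemma link_next p q q' l l' : link p q l -> link p q' l' -> q = q' /\ l = l'.
Proof.
case: p q q' => [v e] [w f] [w' f'] [/= Fe Ff vw hl] [/= _ Ff' vw' hl'].
case: hl hl' => [[h hf ->]|[h hf ->]] [[h' hf' ->]|[h' hf' ->]].
- have ww' := future_out timedM h h' vw vw'.
  move: ww' h' f' hf' {Ff' vw'} => <- h' f'.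
  by rewrite (Prop_irrelevance h' h) hf => ->.
- case: (F_neq0 Ff); rewrite -hf -hf'; exact: (future_zero timedM).
- case: (F_neq0 Ff'); rewrite -hf' -hf; exact: (future_zero timedM).
have ww' := future_in timedM h h' vw vw'.
move: ww' h' f' hf' {vw'} Ff' => <- h' f'.
rewrite (Prop_irrelevance h' h) => hf' Ff'.
have [_ inj] := F_monomial h; suff -> : f = f' by [].
by apply: inj; rewrite ?hf ?hf' //; exact: F_neq0.
Qed.

Lemma link_prev p p' q l l' : link p q l -> link p' q l' -> p = p'.
Proof.
case: p p' q => [v e] [v' e'] [w f] [/= Fe Ff vw hl] [/= Fe' _ vw' hl'].
case: hl hl' => [[h hf _]|[h hf _]] [[h' hf' _]|[h' hf' _]].
- have vv' := past_in timedM h h' vw vw'.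
  move: vv' h' e' hf' {vw'} Fe' => <- h' e'.
  rewrite (Prop_irrelevance h' h) => hf' Fe'.
  have [_ inj] := F_monomial h; suff -> : e = e' by [].
  by apply: inj; rewrite ?hf ?hf' //; exact: F_neq0.
- case: (F_neq0 Fe'); rewrite -hf' -hf; exact: (past_zero timedM).
- case: (F_neq0 Fe); rewrite -hf -hf'; exact: (past_zero timedM).
have vv' := past_out timedM h h' vw vw'.
move: vv' h' e' hf' {Fe' vw'} => <- h' e'.
by rewrite (Prop_irrelevance h' h) hf => ->.
Qed.

Lemma link_letter p q l : link p q l ->
  [/\ lsrc l = projT1 p, ltgt l = projT1 q & (time_of (lsrc l) < time_of (ltgt l))%N].
Proof. by move=> [_ _ pq [[h _ ->]|[h _ ->]]]. Qed.

Fixpoint track (p : elt) (s : seq (letter Q)) (q : elt) : Prop :=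
  if s is l :: s' then exists2 r, link p r l & track r s' q else p = q.

Lemma track_cat p s t q :
  track p (s ++ t) q <-> exists2 r, track p s r & track r t q.
Proof.
elim: s p => /= [|l s IH] p; first by split=> [?|[r ->]] //; exists p.
split=> [[r pr /IH[m rm mq]]|[m [r pr rm] mq]].
  by exists m => //; exists r.
by exists r => //; apply/IH; exists m.
Qed.

Lemma track1 p q l : track p [:: l] q <-> link p q l.
Proof. by split=> [[r pr <-]|pq] //; exists q. Qed.

Lemma track_time p s q : track p s q ->
  (time_of (projT1 p) + size s <= time_of (projT1 q))%N.
Proof.
elim: s p => /= [|l s IH] p; first by move=> ->; rewrite addn0.
move=> [r [_ _ pr _] /IH]; apply: leq_trans.
by rewrite addnS -addSn leq_add2r.
Qed.

Definition first_elt p := forall q l, ~ link q p l.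
Definition last_elt p := forall q l, ~ link p q l.

Lemma track_to_last p : exists s q, track p s q /\ last_elt q.
Proof.
move: {2}(n - time_of (projT1 p))%N (leqnn (n - time_of (projT1 p))) => m.
elim: m p => [|m IH] p pm.
  by move: pm; rewrite leqn0 subn_eq0 leqNgt time_bound.
have [[q [l pq]]|np] := pselect (exists q l, link p q l); last first.
  by exists [::], p; split=> // q l pq; apply: np; exists q, l.
have [|s [r [qr lr]]] := IH q; last by exists (l :: s), r; split=> //; exists q.
have [_ _ lt_pq _] := pq.
by rewrite -ltnS; apply: leq_trans pm; rewrite ltn_sub2l.
Qed.

Lemma track_from_first p : exists q s, track q s p /\ first_elt q.
Proof.
move: {2}(time_of (projT1 p)).+1 (ltnSn (time_of (projT1 p))) => m.
elim: m p => // m IH p pm.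
have [[q [l qp]]|np] := pselect (exists q l, link q p l); last first.
  by exists p, [::]; split=> // q l qp; apply: np; exists q, l.
have [_ _ lt_qp _] := qp.
have [|r [s [rq fr]]] := IH q; first exact: leq_trans lt_qp pm.
by exists r, (s ++ [:: l]); split=> //; apply/track_cat; exists q => //; apply/track1.
Qed.

Lemma track_prefix p s q t r : track p s q -> track p t r -> last_elt r ->
  exists2 t', t = s ++ t' & track q t' r.
Proof.
move=> + + lr; elim: s p t => /= [|l s IH] p t; first by move=> -> ?; exists t.
move=> [m pm mq]; case: t => [/= pr|l' t /= [m' pm' m'r]].
  by rewrite pr in pm; case: (lr _ _ pm).
have [mm' <-] := link_next pm pm'; rewrite -mm' in m'r.
by have [t' -> qr] := IH _ _ mq m'r; exists t'.
Qed.

(** Going back in time is deterministic, so tracks that meet have met at the later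
    of their two beginnings. *)
Lemma track_merge p s p' s' q : track p s q -> track p' s' q ->
  (exists t, track p t p') \/ (exists t, track p' t p).
Proof.
elim: s p => /= [|l s IH] p; first by move=> -> ?; right; exists s'.
move=> [r pr rq] p'q; have [[t rp']|[t]] := IH r rq p'q.
  by left; exists (l :: t), r.
case/lastP: t => [/= ->|t l'].
  by left; exists [:: l]; apply/track1.
rewrite -cats1 => /track_cat[m p'm /track1 mr].
by right; exists t; rewrite (link_prev pr mr).
Qed.

Lemma track_diverge p s q s' q' : track p s q -> track p s' q' ->
  (exists t, track q t q') \/ (exists t, track q' t q).
Proof.
elim: s p s' => /= [|l s IH] p s'; first by move=> -> ?; left; exists s'.
move=> [r pr rq]; case: s' => [/= <-|l' s' /= [r' pr' r'q']].
  by right; exists (l :: s), r.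
by apply: IH rq _; have [-> _] := link_next pr pr'; exact: r'q'.
Qed.

Lemma track_composable p s q : track p s q ->
  @composable Q (projT1 p) s.
Proof.
elim: s p => //= l s IH p [r /link_letter[lp lr _] rq].
by split=> //; rewrite lr; exact: IH rq.
Qed.

(** A letter followed by its reverse would go back in time. *)
Lemma track_no_backtrack p s q l l' : track p s q ->
  subword [:: l; l'] s -> l <> lrev l'.
Proof.
move=> pq [s1 [s2 es]]; move: pq; rewrite es => /track_cat[r _ /=].
move=> [m /link_letter[_ _ lt1] [m' /link_letter[_ _ lt2] _]] ll'.
have [e1 e2] : lsrc l = ltgt l' /\ ltgt l = lsrc l'.
  by rewrite ll' /lsrc /ltgt /=; case: l'.2.
by move: lt1; rewrite e1 e2 ltnNge ltnW.
Qed.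

Lemma track_F p s q : track p s q -> F (projT2 p) -> F (projT2 q).
Proof.
by elim: s p => /= [|l s IH] p; [move=> ->|move=> [r [_ Fr _ _] /IH{}IH] _; exact: IH].
Qed.

(** Each component has a single vector without a link to the past, which serves as
    its index. *)
Definition start : choiceType :=
  {p : {classic elt} | `[< F (projT2 (p : elt)) /\ first_elt p >]}.

Definition start_elt (j : start) : elt := sval j.

Lemma startP j : F (projT2 (start_elt j)) /\ first_elt (start_elt j).
Proof. by apply/asboolP; exact: (svalP j). Qed.

Definition start_seq (j : start) : seq (letter Q) :=
  sval (cid (track_to_last (start_elt j))).

Lemma start_seqP j : exists2 q, track (start_elt j) (start_seq j) q & last_elt q.
Proof.
rewrite /start_seq; case: cid => s /= [q [sq lq]]; by exists q.
Qed.

Definition start_word (j : start) : qword Q :=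
  (projT1 (start_elt j), start_seq j).

Definition reach (j : start) a (x : rsp M a) : Prop :=
  exists s, track (start_elt j) s (existT _ a x).

Lemma reach_uniq j a (x y : rsp M a) : reach j x -> reach j y -> x = y.
Proof.
have main z z' t : track (existT _ a z) t (existT _ a z') -> z = z'.
  case: t => [/= e|l t]; first exact: Eqdep.EqdepTheory.inj_pairT2 e.
  by move=> /track_time /=; rewrite addnS ltnNge leq_addr.
move=> [s tx] [s' ty].
by have [[t /main]|[t /main]] := track_diverge tx ty.
Qed.

Lemma reach_F j a (x : rsp M a) : reach j x -> F x.
Proof. by move=> [s /track_F]; apply; case: (startP j). Qed.

Lemma reach_start a (x : rsp M a) : F x -> exists j, reach j x.
Proof.
move=> Fx; have [q [s [qx fq]]] := track_from_first (existT _ a x).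
have Fq : F (projT2 q).
  by case: s qx => /= [->//|l s [r [Fq _ _ _]]].
pose j : start := exist _ (q : {classic elt}) (asboolT (conj Fq fq)).
by exists j, s.
Qed.

Lemma reach_inj j j' a (x : rsp M a) : reach j x -> reach j' x -> j = j'.
Proof.
move=> [s jx] [s' j'x]; apply: val_inj; change (start_elt j = start_elt j').
have [[t]|[t]] := track_merge jx j'x.
  case/lastP: t => // t l; rewrite -cats1 => /track_cat[m _ /track1 mj'].
  by case: ((startP j').2 _ _ mj').
case/lastP: t => [/= ->//|t l]; rewrite -cats1 => /track_cat[m _ /track1 mj].
by case: ((startP j).2 _ _ mj).
Qed.

Lemma through_reach j a :
  through_vtx (start_word j) a <-> exists x : rsp M a, reach j x.
Proof.
have [q tq lq] := start_seqP j; split.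
  move=> [->|[l [s1 [s2 es]] ->]].
    by exists (projT2 (start_elt j)), [::]; rewrite /= -sigT_eta.
  move: tq; rewrite /= in es; rewrite es -cat1s catA => /track_cat[[w y] sr _].
  have -> : ltgt l = w.
    by move: sr => /track_cat[m _ /track1 /link_letter[_ -> _]].
  by exists y, (s1 ++ [:: l]).
move=> [x [s sx]]; have [t et _] := track_prefix sx tq lq.
case/lastP: s sx et => [/= jx _|s l]; first by left; rewrite /= jx.
rewrite -cats1 => /track_cat[m _ /track1 /link_letter[_ lw _]] et.
by right; exists l => //; exists s, t; rewrite /= et -catA.
Qed.

Definition start_vec j a : rsp M a := xget 0 [set x | reach j x].

Lemma start_vecP j a (x : rsp M a) : reach j x -> start_vec j a = x.
Proof. by move=> jx; apply: xget_unique => // y jy; exact: reach_uniq jy jx. Qed.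

Lemma start_vec_reach j a : through_vtx (start_word j) a -> reach j (start_vec j a).
Proof. by move=> /through_reach[x jx]; rewrite (start_vecP jx). Qed.

Lemma start_arr j al : through_arr (start_word j) al ->
  [/\ through_vtx (start_word j) (src al), through_vtx (start_word j) (tgt al) &
      rmap M al (start_vec j (src al)) = start_vec j (tgt al)].
Proof.
move=> [e [s1 [s2 es]]]; have [q] := start_seqP j.
rewrite /= in es; rewrite es => /track_cat[p jp [r pr _]] _.
have jr : track (start_elt j) (s1 ++ [:: (al, e)]) r.
  by apply/track_cat; exists p => //; apply/track1.
case: p r pr jp jr => [v x] [w y] [/= _ _ _ [[h hx [-> _]]|[h hx [-> _]]]] jp jr /=.
  have jx : reach j x by exists s1.
  have jy : reach j y by exists (s1 ++ [:: (mkarr h, e)]).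
  split; [by apply/through_reach; exists x|by apply/through_reach; exists y|].
  by rewrite (start_vecP jx) (start_vecP jy).
have jx : reach j x by exists s1.
have jy : reach j y by exists (s1 ++ [:: (mkarr h, e)]).
split; [by apply/through_reach; exists y|by apply/through_reach; exists x|].
by rewrite (start_vecP jx) (start_vecP jy).
Qed.

(** If the image of a vector of the string were nonzero, it would be a basis vector
    linked to it, and the string would pass through the arrow. *)
Lemma start_end j al : through_vtx (start_word j) (src al) ->
  ~ through_arr (start_word j) al -> rmap M al (start_vec j (src al)) = 0.
Proof.
case: al => -[x y] h; rewrite /= in h *.
move=> /start_vec_reach jx nal; apply: contrapT => nz.
have Fx := reach_F jx; have [/(_ _ Fx)[//|Fy] _] := F_monomial h.
have [q tq lq] := start_seqP j; apply: nal.
case: (ltngtP (time_of x) (time_of y)) => [xy|yx|/(time_neq timedM h)//].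
  have xl : link (existT _ x (start_vec j x)) (existT _ y (amap M h (start_vec j x)))
      (mkarr h, true) by split=> //; left; exists h.
  have [s sx] := jx.
  have syx : track (start_elt j) (s ++ [:: (mkarr h, true)])
      (existT _ y (amap M h (start_vec j x))).
    by apply/track_cat; eexists; [exact: sx|apply/track1].
  have [t et _] := track_prefix syx tq lq.
  by exists true, s, t; rewrite /= et -catA.
have yl : link (existT _ y (amap M h (start_vec j x))) (existT _ x (start_vec j x))
    (mkarr h, false) by split=> //; right; exists h.
have [s sx] := jx; case/lastP: s sx => [/= jE|s l].
  by have [_ fj] := startP j; rewrite jE in fj; case: (fj _ _ yl).
rewrite -cats1 => /[dup] sx /track_cat[m _ /track1 mx].
exists false; have [t et _] := track_prefix sx tq lq.
exists s, t; rewrite /= et -catA.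
suff -> : l = (mkarr h, false) by [].
have em := link_prev mx yl; rewrite em in mx.
by have [_] := link_next mx yl.
Qed.

Lemma start_span a v :
  lspan [set start_vec j a | j in [set j | through_vtx (start_word j) a]] v.
Proof.
have [_ _ /(_ v I)] := F_basis a; apply: lspan_mono => x Fx.
have [j jx] := reach_start Fx; exists j; last exact: start_vecP.
by apply/through_reach; exists x.
Qed.

Lemma start_free a j : through_vtx (start_word j) a ->
  ~ lspan [set start_vec j' a | j' in
      [set j' | through_vtx (start_word j') a /\ j' <> j]] (start_vec j a).
Proof.
move=> /start_vec_reach jx; have [_ fF _] := F_basis a.
apply: contra_not (fF _ (reach_F jx)); apply: lspan_mono => _ [j' [tj' j'j] <-].
have j'y := start_vec_reach tj'; split; first exact: reach_F j'y.
by move=> e; apply: j'j; rewrite e in j'y; exact: reach_inj j'y jx.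
Qed.

Lemma start_sum : is_direct_sum (N := fun j => string_module k (start_word j))
  (fun j => string_incl (M := M) start_word start_vec j).
Proof.
apply: string_sum; [exact: start_arr|exact: start_end|exact: start_span|].
exact: start_free.
Qed.

End Strings.

(** * Relations and strings *)

Local Notation path_map M w := (@Defs.path_map _ _ M _ _ w).

Section Relations.
Variables (k : fieldType) (Q : quiver).

Fact path_map_linear (M : rep k Q) a b (w : qpath a b) : linear (path_map M w).
Proof.
by elim: w => [c|al c w IH] c' x y //=; rewrite linearP IH.
Qed.

HB.instance Definition _ (M : rep k Q) a b (w : qpath a b) :=
  GRing.isLinear.Build k (rsp M a) (rsp M b) *:%R (path_map M w)
    (@path_map_linear M a b w).

Lemma path_map_cat (M : rep k Q) a b c (u : qpath a b) (w : qpath b c) m :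
  path_map M (qcat u w) m = path_map M w (path_map M u m).
Proof. by elim: u w m => //= al d u IH w m; rewrite IH. Qed.

(** The elements that act as zero form a two-sided ideal. *)
Lemma satisfies_ideal (M : rep k Q) (G : forall a b, qpath a b -> Prop) :
  (forall a b (w : qpath a b), G a b w -> forall m, path_map M w m = 0) ->
  satisfies M (@ideal k Q G).
Proof.
move=> MG a b x; elim=> {a b x}[a b w Gw|a b|a b c x y _ IHx _ IHy|a b c d u x v _ IH] m.
- by rewrite liftU scale1r MG.
- by rewrite linear0.
- by rewrite linearP /= IHx IHy scaler0 addr0.
have E y : fglift (fun w : {classic qpath a d} => path_map M w m) (qpath_mul u y v)
    = path_map M v (fglift (fun w : {classic qpath b c} =>
        path_map M w (path_map M u m)) y).
  rewrite /qpath_mul -[y in LHS]freeg_sumE -[y in RHS]freeg_sumE !raddf_sum /=.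
  apply: eq_bigr => w _; rewrite !liftU linearZ /=.
  by rewrite linearZ /= liftU scale1r !path_map_cat.
by rewrite E IH linear0.
Qed.

Definition zero_rep : rep k Q := @Rep k Q (fun _ => 'rV[k]_1) (fun _ => \0).

(** Trivial paths act as nonzero on the representation [zero_rep], which satisfies
    all relations between non-trivial paths. *)
Lemma ideal_nontrivial (G : forall a b, qpath a b -> Prop) :
  (forall a b (w : qpath a b), G a b w -> arrows w <> [::]) ->
  forall a b (w : qpath a b), @ideal k Q G a b (qpath_elt k w) -> arrows w <> [::].
Proof.
move=> Gw a b w Iw; have sat : satisfies zero_rep (@ideal k Q G).
  apply: satisfies_ideal => {}a {}b {Iw}w /Gw; case: w => //= al c w _ m.
  exact: (linear0 (path_map zero_rep w)).
case: w Iw => //= c /sat /(_ (const_mx 1)); rewrite liftU scale1r /= => /rowP/(_ 0).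
by rewrite !mxE => /eqP; rewrite oner_eq0.
Qed.

Lemma rev_map_split (T S : Type) (f : T -> S) x A t B y :
  rev (map f (x ++ (A ++ t :: B) ++ y)) =
  rev (map f (B ++ y)) ++ [:: f t] ++ rev (map f (x ++ A)).
Proof.
have -> : x ++ (A ++ t :: B) ++ y = (x ++ A) ++ t :: (B ++ y) by rewrite -!catA.
by rewrite map_cat rev_cat /= rev_cons cat_rcons.
Qed.

(** Along a path inside a word, M maps a vector of the word to a vector of the
    word, hence acts as nonzero; so no such path can lie in an ideal of relations
    of M. *)
Lemma is_string_of_vectors (M : rep k Q) (G : forall a b, qpath a b -> Prop)
    (u : qword Q) (v : forall a, rsp M a) :
  (forall a b (w : qpath a b), G a b w -> arrows w <> [::]) ->
  satisfies M (@ideal k Q G) ->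
  composable u.1 u.2 ->
  (forall l l', subword [:: l; l'] u.2 -> l <> lrev l') ->
  (forall al, through_arr u al -> [/\ through_vtx u (src al),
      through_vtx u (tgt al) & rmap M al (v (src al)) = v (tgt al)]) ->
  (forall a, through_vtx u a -> v a <> 0) ->
  is_string (@ideal k Q G) u.
Proof.
move=> Gw sat uc unb u_arr v0; split=> // a b w Iw /=.
have main : ~ forall al s1 s2, arrows w = s1 ++ al :: s2 -> through_arr u al.
  move=> thr; have [tb vb] : through_vtx u b /\ path_map M w (v a) = v b.
    move: (ideal_nontrivial Gw Iw) thr; elim: w {Iw} => //= al c w IH _ thr.
    have [_ tt ->] := u_arr _ (thr al [::] (arrows w) erefl).
    have thr' al' s1 s2 : arrows w = s1 ++ al' :: s2 -> through_arr u al'.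
      by move=> ew; apply: (thr al' (al :: s1) s2); rewrite ew.
    have [w0|w0] := pselect (arrows w = [::]); last exact: IH.
    by clear IH thr thr'; case: w w0 tt.
  apply: (v0 b tb); rewrite -vb.
  by have := sat _ _ _ Iw (v a); rewrite liftU scale1r.
split=> -[x [y e]]; apply: main => al s1 s2 ew; rewrite ew map_cat /= in e.
  exists true, (x ++ [seq (al, true) | al <- s1]), ([seq (al, true) | al <- s2] ++ y).
  by rewrite e -!catA.
have lrevK : cancel (@lrev Q) (@lrev Q) by case=> al' [].
have eu : u.2 = rev [seq lrev l | l <- rev [seq lrev l | l <- u.2]].
  by rewrite -map_rev revK (mapK lrevK).
exists false, (rev [seq lrev l | l <- [seq (al, true) | al <- s2] ++ y]).
exists (rev [seq lrev l | l <- x ++ [seq (al, true) | al <- s1]]).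
rewrite eu e; exact: rev_map_split.
Qed.

End Relations.

(** * Uniqueness of the string decomposition *)

Lemma chain_join (T : Type) (C : set (set T)) G H : total_on C subset ->
  C G -> C H -> exists2 K, C K & G `<=` K /\ H `<=` K.
Proof.
move=> tC CG CH; have [GH|HG] := tC _ _ CG CH.
  by exists H => //; split=> //; exact: subset_refl.
by exists G => //; split=> //; exact: subset_refl.
Qed.

Section Exchange.
Variables (k : fieldType) (V : lmodType k) (J J' : Type).
Variables (v : J -> V) (e : J' -> V) (r : J -> J' -> Prop).
Hypothesis v_free : forall j, ~ lspan [set v i | i in [set i | i <> j]] (v j).
Hypothesis v_span : forall j, lspan [set e j' | j' in r j] (v j).

(** G is a partial map from J to J'; the vector at i becomes e (G i) where G is
    defined, and stays v i elsewhere. *)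
Definition exchanged (G : set (J * J')) (i : J) (x : V) : Prop :=
  (exists2 j', G (i, j') & x = e j') \/ ((forall j', ~ G (i, j')) /\ x = v i).

Definition exchanged_away (G : set (J * J')) (i : J) : set V :=
  [set x | exists2 i', i' <> i & exchanged G i' x].

Definition partial_exchange (G : set (J * J')) : Prop :=
  [/\ forall i j', G (i, j') -> r i j',
      forall i j1 j2, G (i, j1) -> G (i, j2) -> j1 = j2 &
      forall i x, exchanged G i x -> ~ lspan (exchanged_away G i) x].

(** The finitely many vectors of a linear combination have all taken their final
    form at some stage of the chain. *)
Lemma exchanged_chain (C : set (set (J * J'))) i x :
  total_on C subset -> (exists G, C G) ->
  lspan (exchanged_away (\bigcup_(G in C) G) i) x ->
  exists2 G, C G & forall H, C H -> G `<=` H -> lspan (exchanged_away H i) x.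
Proof.
move=> tC [G0 CG0]; elim=> [|c y x' [i' i'i ey] _ [G CG GH]].
  by exists G0 => // H _ _; exact: lspan0.
case: ey => [[j' [G1 CG1 G1ij] yE]|[nG yE]].
  have [G2 CG2 [GG2 G1G2]] := chain_join tC CG CG1.
  exists G2 => // H CH G2H; apply: lspanS; last exact: GH (subset_trans GG2 G2H).
  by exists i' => //; left; exists j' => //; apply: G2H; exact: G1G2.
exists G => // H CH GH'; apply: lspanS; last exact: GH.
by exists i' => //; right; split=> // j' Hij; apply: (nG j'); exists H.
Qed.

Lemma partial_exchange_chain (C : set (set (J * J'))) :
  C `<=` partial_exchange -> total_on C subset ->
  partial_exchange (\bigcup_(G in C) G).
Proof.
move=> CP tC; have [[G0 CG0]|nC] := pselect (exists G, C G); last first.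
  have -> : \bigcup_(G in C) G = set0.
    by rewrite -subset0 => x [G CG]; case: nC; exists G.
  split; [by move=> ? ? []|by move=> ? ? ? []|move=> i x [[j' []]|[_ ->]]].
  apply: contra_not (v_free (j := i)).
  by apply: lspan_mono => y [i' i'i [[j' []]|[_ ->]]]; exists i'.
split=> [i j' [G CG]|i j1 j2 [G CG Gi] [H CH Hi]|i x ex].
- by case: (CP G CG) => rG _ _; exact: rG.
- have [GH|HG] := tC _ _ CG CH.
    by case: (CP H CH) => _ fH _; apply: fH Hi; exact: GH.
  by case: (CP G CG) => _ fG _; apply: fG Gi _; exact: HG.
move=> /(exchanged_chain tC)[]; first by exists G0.
move=> G CG GH; case: ex => [[j' [G1 CG1 G1i] xE]|[nG xE]].
  have [G2 CG2 [GG2 G1G2]] := chain_join tC CG CG1.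
  case: (CP G2 CG2) => _ _ /(_ i x); apply; last exact: GH.
  by left; exists j' => //; exact: G1G2.
case: (CP G CG) => _ _ /(_ i x); apply; last exact: GH.
by right; split=> // j' Gij; apply: (nG j'); exists G.
Qed.

(** Steinitz exchange in any dimension: in a maximal independent exchange no v j is
    left, since otherwise one of the e j' needed to write v j lies outside of the
    span of the other vectors, and could replace v j. *)
Lemma exchange : exists2 g : J -> J', injective g & forall j, r j (g j).
Proof.
have [G [[rG fG iG] maxG]] := Zorn_bigcup partial_exchange_chain.
have total j : exists j', G (j, j').
  apply: contrapT => nj; have nG j' : ~ G (j, j') by move=> ?; apply: nj; exists j'.
  have vj : ~ lspan (exchanged_away G j) (v j) by apply: iG; right.
  have [j' rj ej] : exists2 j', r j j' & ~ lspan (exchanged_away G j) (e j').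
    apply: contrapT => nr; apply: vj; apply: lspan_min (v_span j).
      exact: lspan_lsubspace.
    by move=> _ [j' rj <-]; apply: contrapT => ne; apply: nr; exists j'.
  pose G' := (j, j') |` G.
  have exG' i x : exchanged G' i x -> (i = j /\ x = e j') \/ (i <> j /\ exchanged G i x).
    have [->|ij] := pselect (i = j).
      move=> [[j1 [[->]|/nG//] ->]|[/(_ j') nGj _]]; first by left.
      by case: nGj; left.
    move=> ex; right; split=> //.
    case: ex => [[j1 [[/ij//]|Gi] ->]|[nGi ->]]; first by left; exists j1.
    by right; split=> // j1 Gi; apply: (nGi j1); right.
  apply: (maxG G'); first split.
  - by move=> x Gx; right.
  - by move=> GG; apply: (nG j'); apply: GG; left.
  split=> [i j1 [[-> ->]//|/rG//]|i j1 j2 [e1|Gi1] [e2|Gi2]|i x].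
  - exact: etrans (congr1 snd e1) (esym (congr1 snd e2)).
  - by case: e1 Gi2 => -> _ /nG.
  - by case: e2 Gi1 => -> _ /nG.
  - exact: fG Gi1 Gi2.
  move=> /exG'[[-> ->]|[ij ex]].
    apply: contra_not ej; apply: lspan_mono => y [i' i'j /exG'[[]//|[_ ey]]].
    by exists i'.
  pose A := [set y | exists i', [/\ i' <> i, i' <> j & exchanged G i' y]].
  have AG i' : i' = i \/ i' = j -> lspan A `<=` lspan (exchanged_away G i').
    by case=> ->; apply: lspan_mono => y [i0 [? ? ?]]; exists i0.
  move=> sx; have /lspan_adjoin[c xc] : lspan (e j' |` A) x.
    apply: lspan_mono sx => y [i' i'i /exG'[[_ ->]|[i'j ey]]]; first by left.
    by right; exists i'.
  have [c0|c0] := eqVneq c 0.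
    move: xc; rewrite c0 scale0r subr0 => /AG xi; apply: (iG i x ex).
    by apply: xi; left.
  apply: ej; apply: (lspan_cancel c0 (x := x)); last by apply: AG xc; right.
  by apply: lspan_incl; exists i.
have /choice[g Gg] := total.
exists g => [i j gij|j]; last exact/rG/Gg.
apply: contrapT => ij; apply: (iG i (e (g i))); first by left; exists (g i).
apply: lspan_incl; exists j; first exact/nesym.
by left; exists (g j); rewrite ?gij.
Qed.

End Exchange.

(** The bijection of Cantor and Bernstein sends each element to its image by one
    injection or to a preimage by the other, so it keeps every relation that
    both injections keep. *)
Lemma cantor_bernstein_rel (J J' : Type) (g : J -> J') (h : J' -> J)
    (r : J -> J' -> Prop) :
  injective g -> injective h -> (forall j, r j (g j)) -> (forall j', r (h j') j') ->
  exists2 s : J -> J', bijective s & forall j, r j (s j).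
Proof.
move=> gI hI rg rh.
(* The elements whose history under g and h begins outside of the range of h. *)
pose D j := exists n j0, ~ range h j0 /\ j = iter n (h \o g) j0.
have DS j : D j -> D (h (g j)).
  by move=> [n [j0 [nj0 ->]]]; exists n.+1, j0.
have Dh j : ~ D j -> exists j', h j' = j.
  move=> nD; apply: contrapT => nj; apply: nD; exists 0%N, j; split=> //.
  by move=> [j' _ e]; apply: nj; exists j'.
have Dinv j' : D (h j') -> exists2 j, D j & g j = j'.
  move=> [[|n] [j0 [nj0 /= e]]]; first by case: nj0; exists j'.
  by exists (iter n (h \o g) j0); [exists n, j0|apply: hI].
have /choice[s sP] : forall j, exists j', (D j -> j' = g j) /\ (~ D j -> h j' = j).
  move=> j; have [Dj|nDj] := pselect (D j); first by exists (g j).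
  by have [j' ?] := Dh j nDj; exists j'.
have /choice[t tP] : forall j', exists j, (D (h j') -> D j /\ g j = j') /\
    (~ D (h j') -> j = h j').
  move=> j'; have [Dj|nDj] := pselect (D (h j')); last by exists (h j').
  by have [j ? ?] := Dinv j' Dj; exists j.
exists s; last first.
  move=> j; have [Dj|nDj] := pselect (D j); first by rewrite ((sP j).1 Dj).
  by rewrite -{1}((sP j).2 nDj).
exists t => [j|j'].
  have [Dj|nDj] := pselect (D j).
    rewrite ((sP j).1 Dj); apply: gI.
    by have [_ ->] := (tP (g j)).1 (DS _ Dj).
  have hs := (sP j).2 nDj; rewrite (tP (s j)).2 ?hs //.
have [Dj|nDj] := pselect (D (h j')).
  by have [Dt gt] := (tP j').1 Dj; rewrite (sP _).1.
rewrite ((tP j').2 nDj); apply: hI; exact: (sP _).2.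
Qed.

Section Words.
Variable Q : quiver.
Implicit Types (u w : qword Q) (al : arr Q) (a : vtx Q).

(** The relation under which two words give the same string module: a word is not
    distinguished from its reverse. *)
Definition same_word u w : Prop :=
  (forall a, through_vtx u a <-> through_vtx w a) /\
  (forall al, through_arr u al <-> through_arr w al).

Lemma same_word_sym u w : same_word u w -> same_word w u.
Proof. by move=> [uv ua]; split=> [a|al]; rewrite ?uv ?ua. Qed.

Lemma same_word_trans u v w : same_word u v -> same_word v w -> same_word u w.
Proof. by move=> [uv ua] [wv wa]; split=> [a|al]; rewrite ?uv ?ua. Qed.

Lemma composable_cat a (s t : seq (letter Q)) :
  composable a (s ++ t) -> composable (last a [seq ltgt l | l <- s]) t.
Proof. by elim: s a => //= l s IH a [_ /IH]. Qed.

Lemma through_arr_vtx u al : composable u.1 u.2 -> through_arr u al ->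
  through_vtx u (src al) /\ through_vtx u (tgt al).
Proof.
case: u => a s /= us [e [s1 [s2 /= es]]].
have tl : through_vtx (a, s) (ltgt (al, e)) by right; exists (al, e) => //; exists s1, s2.
have sl : through_vtx (a, s) (lsrc (al, e)).
  move: us; rewrite es => /composable_cat /= [-> _].
  case/lastP: s1 es => [|s1 l] es; first by left.
  right; exists l; last by rewrite map_rcons last_rcons.
  by exists s1, ((al, e) :: s2); rewrite /= cat_rcons.
by case: e {es} tl sl.
Qed.

(** Each letter of the word transports P between the vertices it joins. *)
Lemma word_connected u (P : vtx Q -> Prop) : composable u.1 u.2 ->
  (forall al, through_arr u al -> P (src al) <-> P (tgt al)) ->
  forall a b, through_vtx u a -> P a -> through_vtx u b -> P b.
Proof.
case: u => a0 s /= us uP.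
suff base : forall a, through_vtx (a0, s) a -> (P a <-> P a0).
  by move=> a b /base ha Pa /base hb; apply/hb/ha.
move=> a [->//|[l [s1 [s2 /= es]] ->]].
elim/last_ind: s1 l s2 es => [|s1 l' IH] l s2 es.
  move: us; rewrite es /= => -[<- _].
  have := uP l.1 (ex_intro _ l.2 (ex_intro _ [::] (ex_intro _ s2 _))).
  by rewrite es -surjective_pairing => /(_ erefl); rewrite /lsrc /ltgt; case: l.2 => ->.
have := IH l' (l :: s2); rewrite es cat_rcons => /(_ erefl) <-.
move: us; rewrite es => /composable_cat /= [].
rewrite map_rcons last_rcons => <- _.
have := uP l.1 (ex_intro _ l.2 (ex_intro _ (rcons s1 l') (ex_intro _ s2 _))).
by rewrite es -surjective_pairing => /(_ erefl); rewrite /lsrc /ltgt; case: l.2 => ->.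
Qed.

Lemma through_base u : through_vtx u u.1.
Proof. by left. Qed.

Variable k : fieldType.
Implicit Types c d : vtx Q -> k.

(** The scalars by which a morphism from the string module of u to that of w
    acts at the vertices. *)
Record word_hom u w c : Prop := WordHom {
  hom_supp : forall a, c a != 0 -> through_vtx u a /\ through_vtx w a;
  hom_arr : forall al, through_arr u al -> through_arr w al ->
    c (src al) = c (tgt al);
  hom_out : forall al, through_arr u al -> ~ through_arr w al -> c (tgt al) = 0;
  hom_in : forall al, ~ through_arr u al -> through_arr w al -> c (src al) = 0 }.

Lemma word_hom_const u w c a b : composable u.1 u.2 -> same_word u w ->
  word_hom u w c -> through_vtx u a -> through_vtx u b -> c a = c b.
Proof.
move=> us [_ uw] hc ua ub.
apply: (word_connected (P := fun z => c a = c z) us _ ua) => // al ual.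
by rewrite (hom_arr hc ual) //; apply/uw.
Qed.

(** Wherever both scalars are nonzero, an arrow in one of the words is in the other
    one as well, since otherwise one of the morphisms would vanish at an end of
    it.  By connectedness this spreads over both words. *)
Lemma word_hom_same u w u' c d a : composable u.1 u.2 -> composable w.1 w.2 ->
  same_word u u' -> word_hom u w c -> word_hom w u' d -> c a * d a != 0 ->
  same_word u w.
Proof.
move=> us ws [uu'v uu'a] hc hd; rewrite mulf_eq0 negb_or => /andP[ca da].
pose P z := c z != 0 /\ d z != 0.
have [ua wa] := hom_supp hc ca.
have arr_uw al : through_arr u al -> P (src al) \/ P (tgt al) -> through_arr w al.
  move=> ual Pal; apply: contrapT => nw.
  case: Pal => -[cz dz]; last by rewrite (hom_out hc ual nw) eqxx in cz.
  by rewrite (hom_in hd nw) ?eqxx // in dz; apply/uu'a.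
have arr_wu al : through_arr w al -> P (src al) \/ P (tgt al) -> through_arr u al.
  move=> wal Pal; apply: contrapT => nu.
  case: Pal => -[cz dz]; first by rewrite (hom_in hc nu wal) eqxx in cz.
  by rewrite (hom_out hd wal) ?eqxx // in dz; apply: contra_not nu => /uu'a.
have step al : through_arr u al -> through_arr w al -> P (src al) <-> P (tgt al).
  move=> ual wal; rewrite /P (hom_arr hc ual wal) (hom_arr hd wal) //.
  exact/uu'a.
have Pu z : through_vtx u z -> P z.
  apply: (word_connected (P := P) us _ ua) => // al ual.
  by split=> Pz; apply/(step al) => //; apply: arr_uw; auto.
have Pw z : through_vtx w z -> P z.
  apply: (word_connected (P := P) ws _ wa) => // al wal.
  by split=> Pz; apply/(step al) => //; apply: arr_wu; auto.
split=> [z|al]; split.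
- by move=> /Pu[/(hom_supp hc)[]].
- by move=> /Pw[/(hom_supp hc)[]].
- move=> ual; apply: (arr_uw al ual); left; apply: Pu.
  by case: (through_arr_vtx us ual).
- move=> wal; apply: (arr_wu al wal); left; apply: Pw.
  by case: (through_arr_vtx ws wal).
Qed.

Lemma same_word_iso u w : composable u.1 u.2 -> same_word u w ->
  rep_iso (string_module k u) (string_module k w).
Proof.
move=> cu uw.
pose g (u' w' : qword Q) a : {linear rsp (string_module k u') a -> rsp (string_module k w') a} :=
  @row_span k (rsp (string_module k w') a) (string_dim u' a) (const_mx 1).
have gK u' w' a : same_word u' w' -> cancel (g u' w' a) (g w' u' a).
  move=> [uv _] x; apply/eqP; rewrite -subr_eq0; apply/eqP/row_sum_inj.
  rewrite raddfB /= /row_span !linearZ /=.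
  have [ua|na] := pselect (through_vtx u' a); last first.
    by rewrite (string_dim_out x na) raddf0 !mul0r subrr.
  rewrite !row_sum_const ?mulr1 ?subrr //; apply/asboolP => //; exact/uv.
exists (g u w); last first.
  by move=> a; exists (g w u a); apply: gK => //; exact: same_word_sym.
case: uw => uv ua al x.
apply/eqP; rewrite -subr_eq0; apply/eqP/row_sum_inj.
rewrite raddfB /= /row_span !linearZ /= /string_mx.
have -> : `[< through_arr w al >] = `[< through_arr u al >].
  by apply/asbool_equiv_eq; split=> /ua.
case: asboolP; last first.
  by rewrite !mulmx0 !raddf0 !(mulr0, mul0r, addr0, subr0).
move=> ual; have [us ut] := through_arr_vtx cu ual.
have ws : `[< through_vtx w (src al) >] by apply/asboolP/uv.
have wt : `[< through_vtx w (tgt al) >] by apply/asboolP/uv.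
rewrite !row_sum_mul_const //; last exact/asboolP.
by rewrite linearZ /= !row_sum_const // !mulr1 subrr.
Qed.

End Words.

Section Coordinates.
Variables (k : fieldType) (Q : quiver) (M : rep k Q).
Variables (J : choiceType) (u : J -> qword Q).
Variable f : forall j a, {linear rsp (string_module k (u j)) a -> rsp M a}.
Hypothesis fsum : is_direct_sum (N := fun j => string_module k (u j)) f.

Definition coord a (v : rsp M a) : forall j, rsp (string_module k (u j)) a :=
  sval (cid (fsum.2 a v)).

Lemma coordP a (v : rsp M a) :
  finite_set [set j | coord v j <> 0] /\ v = \sum_(j \in [set: J]) f j a (coord v j).
Proof. by rewrite /coord; case: cid => x [[]]. Qed.

Lemma coord_uniq a (v : rsp M a) x : finite_set [set j | x j <> 0] ->
  v = \sum_(j \in [set: J]) f j a (x j) -> coord v = x.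
Proof. by rewrite /coord; case: cid => y /= [_ yx] fx vx; exact: yx. Qed.

Lemma coord_seq a (v : rsp M a) : exists r : seq J, [/\ uniq r,
  forall j, j \notin r -> coord v j = 0 & v = \sum_(j <- r) f j a (coord v j)].
Proof.
have [fv ev] := coordP v; have [r ur vr] := finite_cover fv.
have vr0 j : j \notin r -> coord v j = 0 by move=> /vr /contrapT.
exists r; split=> //; rewrite {1}ev (@fsum_seq _ _ r) // => j /vr0 ->.
exact: linear0.
Qed.

Lemma coord_seq_uniq a (r : seq J) (v : rsp M a) x : uniq r ->
  (forall j, j \notin r -> x j = 0) -> v = \sum_(j <- r) f j a (x j) -> coord v = x.
Proof.
move=> ur xr vx; apply: coord_uniq.
  apply: (sub_finite_set (B := [set` r])); last exact: finite_seq.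
  by move=> j /= nx; apply: contrapT => /negP /xr.
by rewrite (@fsum_seq _ _ r) // => j /xr ->; exact: linear0.
Qed.

Lemma coord_linear a c (v w : rsp M a) j :
  coord (c *: v + w) j = c *: coord v j + coord w j.
Proof.
have [fv ev] := coordP v; have [fw ew] := coordP w.
have [r ur vwr] : exists2 r : seq J, uniq r &
    forall j, j \notin r -> coord v j = 0 /\ coord w j = 0.
  have /finite_cover[r ur vwr] :
      finite_set ([set i | coord v i <> 0] `|` [set i | coord w i <> 0]).
    by rewrite finite_setU.
  exists r => // i /vwr /not_orP[/contrapT ? /contrapT ?]; by split.
pose x i := c *: coord v i + coord w i.
have -> : coord (c *: v + w) = x; last by [].
apply: (coord_seq_uniq ur).
  by move=> i /vwr[vi wi]; rewrite /x vi wi scaler0 addr0.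
under eq_bigr do rewrite linearP.
rewrite big_split /= -scaler_sumr {1}ev {1}ew.
by rewrite !(@fsum_seq _ _ r) // => i /vwr[vi wi]; rewrite ?vi ?wi; exact: linear0.
Qed.

Definition string_proj j a (v : rsp M a) := coord v j.

HB.instance Definition _ j a :=
  GRing.isLinear.Build k (rsp M a) (rsp (string_module k (u j)) a) *:%R
    (@string_proj j a) (fun c v w => coord_linear c v w j).

Lemma string_proj_hom j al (v : rsp M (src al)) :
  string_proj j (rmap M al v) = rmap (string_module k (u j)) al (string_proj j v).
Proof.
have [r [ur vr ev]] := coord_seq v.
pose x i := rmap (string_module k (u i)) al (coord v i).
rewrite /string_proj; have -> : coord (rmap M al v) = x; last by [].
apply: (coord_seq_uniq ur) => [i /vr|].
  by rewrite /x => ->; exact: linear0.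
rewrite {1}ev raddf_sum; apply: eq_bigr => i _.
by rewrite /x (fsum.1 i).
Qed.

Lemma string_proj_incl a i (x : rsp (string_module k (u i)) a) j :
  row_sum (string_proj j (f i a x)) = if j == i then row_sum x else 0.
Proof.
pose y j' : rsp (string_module k (u j')) a :=
  match pselect (i = j') with
  | left e => eq_rect i (fun j' => rsp (string_module k (u j')) a) x j' e
  | right _ => 0
  end.
have yi : y i = x by rewrite /y; case: pselect => // e; rewrite (Prop_irrelevance e erefl).
have yj j' : j' != i -> y j' = 0.
  by rewrite /y; case: pselect => // e /eqP; case.
rewrite /string_proj; have -> : coord (f i a x) = y.
  apply: (@coord_seq_uniq _ [:: i]) => //.
    by move=> j'; rewrite inE; exact: yj.
  by rewrite big_seq1 yi.
by case: eqVneq => [->|/yj ->]; rewrite ?yi // raddf0.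
Qed.

End Coordinates.

Section Uniqueness.
Variables (k : fieldType) (Q : quiver) (M : rep k Q).

Section Comparison.
Variables (J J' : choiceType) (u : J -> qword Q) (u' : J' -> qword Q).
Variable f : forall j a, {linear rsp (string_module k (u j)) a -> rsp M a}.
Variable f' : forall j a, {linear rsp (string_module k (u' j)) a -> rsp M a}.
Hypothesis fsum : is_direct_sum (N := fun j => string_module k (u j)) f.
Hypothesis fsum' : is_direct_sum (N := fun j => string_module k (u' j)) f'.
Hypothesis cu : forall j, composable (u j).1 (u j).2.
Hypothesis cu' : forall j, composable (u' j).1 (u' j).2.

(** The scalar at a of the composite of the inclusion of the summand j of the
    first sum and the projection to the summand j' of the second. *)
Definition transfer j j' a : k := row_sum (string_proj fsum' j' (f j a (const_mx 1))).

Lemma transferE j j' a (x : rsp (string_module k (u j)) a) :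
  row_sum (string_proj fsum' j' (f j a x)) = row_sum x * transfer j j' a.
Proof.
have xE : x = row_sum x *: const_mx 1.
  apply/eqP; rewrite -subr_eq0; apply/eqP/row_sum_inj; rewrite raddfB /= linearZ /=.
  have [ua|na] := pselect (through_vtx (u j) a).
    by rewrite row_sum_const ?mulr1 ?subrr //; exact/asboolP.
  by rewrite (string_dim_out x na) raddf0 mul0r subrr.
by rewrite {1}xE !linearZ.
Qed.

Lemma transfer_hom j j' : word_hom (u j) (u' j') (transfer j j').
Proof.
have arrE al : row_sum
      ((string_proj fsum' j' (f j (src al) (const_mx 1)) :
         'rV[k]_(string_dim (u' j') (src al))) *m string_mx k (u' j') al) =
    row_sum (const_mx 1 *m string_mx k (u j) al) * transfer j j' (tgt al).
  transitivity (row_sum (rmap (string_module k (u' j')) al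
      (string_proj fsum' j' (f j (src al) (const_mx 1))))); first by [].
  by rewrite -string_proj_hom -(fsum.1 j) transferE.
have supp a : transfer j j' a != 0 -> through_vtx (u j) a /\ through_vtx (u' j') a.
  apply: contra_neqP => /not_andP[nu|nw].
    by rewrite /transfer (string_dim_out (const_mx 1) nu) !linear0.
  by rewrite /transfer (string_dim_out (string_proj _ _ _) nw) raddf0.
have mx_in (w : qword Q) al (x : 'rV[k]_(string_dim w (src al))) :
    through_arr w al -> composable w.1 w.2 -> row_sum (x *m string_mx k w al) = row_sum x.
  move=> wal cw; rewrite /string_mx asboolT // row_sum_mul_const //.
  by apply/asboolP; case: (through_arr_vtx cw wal).
have mx_out (w : qword Q) al (x : 'rV[k]_(string_dim w (src al))) :
    ~ through_arr w al -> row_sum (x *m string_mx k w al) = 0.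
  by move=> nw; rewrite /string_mx asboolF // mulmx0 raddf0.
have one al : through_arr (u j) al ->
    row_sum (const_mx 1 : 'rV[k]_(string_dim (u j) (src al))) = 1.
  move=> ual; apply: row_sum_const; apply/asboolP.
  by case: (through_arr_vtx (cu j) ual).
split=> [//|al ual wal|al ual nal|al nal wal]; have := arrE al.
- by rewrite !mx_in // one // mul1r.
- by rewrite mx_out // mx_in // one // mul1r => <-.
- by rewrite mx_in // mx_out // mul0r.
Qed.

End Comparison.

Lemma transfer_comp (J J' : choiceType) (u : J -> qword Q) (u' : J' -> qword Q)
    (f : forall j a, {linear rsp (string_module k (u j)) a -> rsp M a})
    (f' : forall j a, {linear rsp (string_module k (u' j)) a -> rsp M a})
    (fsum : is_direct_sum (N := fun j => string_module k (u j)) f)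
    (fsum' : is_direct_sum (N := fun j => string_module k (u' j)) f') j a :
  through_vtx (u j) a -> exists r : seq J', forall i,
    \sum_(j' <- r) transfer f fsum' j j' a * transfer f' fsum j' i a = (i == j)%:R.
Proof.
move=> ja; have [r [_ _ er]] := coord_seq fsum' (f j a (const_mx 1)).
exists r => i; have := string_proj_incl fsum (const_mx 1 : rsp (string_module k (u j)) a) i.
rewrite {1}er !raddf_sum /= => e; transitivity (if i == j then 1 else 0 : k).
  rewrite row_sum_const in e; last exact/asboolP.
  by rewrite -e; apply: eq_bigr => j' _; rewrite transferE.
by case: eqP.
Qed.

Section Injection.
Variables (J J' : choiceType) (u : J -> qword Q) (u' : J' -> qword Q).
Variable f : forall j a, {linear rsp (string_module k (u j)) a -> rsp M a}.
Variable f' : forall j a, {linear rsp (string_module k (u' j)) a -> rsp M a}.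
Hypothesis fsum : is_direct_sum (N := fun j => string_module k (u j)) f.
Hypothesis fsum' : is_direct_sum (N := fun j => string_module k (u' j)) f'.
Hypothesis cu : forall j, composable (u j).1 (u j).2.
Hypothesis cu' : forall j, composable (u' j).1 (u' j).2.

(** Between summands with the same word, the scalars of the two changes of
    decomposition form mutually inverse matrices, a passage through a summand with
    another word contributing zero.  The rows of the first matrix are thus
    independent, and exchanging them for basis vectors gives the injection. *)
Lemma same_word_injection :
  exists2 g : J -> J', injective g & forall j, same_word (u j) (u' (g j)).
Proof.
pose c j j' := transfer f fsum' j j'.
pose d j' i := transfer f' fsum j' i.
have cP j j' : word_hom (u j) (u' j') (c j j') by exact: transfer_hom.
have dP j' i : word_hom (u' j') (u i) (d j' i) by exact: transfer_hom.
pose A j j' : k := if `[< same_word (u j) (u' j') >] then c j j' (u j).1 else 0.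
pose B j' i : k := if `[< same_word (u' j') (u i) >] then d j' i (u' j').1 else 0.
have AB j : exists r : seq J', forall i,
    \sum_(j' <- r) A j j' * B j' i = (i == j)%:R.
  have [r rP] := transfer_comp fsum fsum' (through_base (u j)).
  exists r => i; have [same|nsame] := pselect (same_word (u j) (u i)).
    rewrite -rP; apply: eq_bigr => j' _; rewrite /A /B.
    case: asboolP => [jj'|njj'].
      have j'i := same_word_trans (same_word_sym jj') same.
      rewrite asboolT //; congr (_ * _).
      apply: (word_hom_const _ j'i (dP j' i)) => //; first exact: through_base.
      by apply/jj'.1; exact: through_base.
    rewrite mul0r; apply/esym/eqP; apply: contra_notT njj' => cd.
    exact: (word_hom_same _ _ same (cP j j') (dP j' i) cd).
  have -> : (i == j) = false by apply: contra_notF nsame => /eqP ->; split.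
  rewrite big1 // => j' _; rewrite /A /B.
  case: asboolP => [jj'|]; last by rewrite mul0r.
  case: asboolP => [j'i|]; last by rewrite mulr0.
  by case: nsame; exact: same_word_trans j'i.
pose V := {freeg J' / k}; pose e (j' : J') : V := << j' >>.
have /choice[r rP] := AB.
pose v j : V := \sum_(j' <- r j) A j j' *: e j'.
(* The columns of B, as linear forms, tell the rows of A apart. *)
have Lv i j : fglift (fun j' => B j' i : k^o) (v j) = (i == j)%:R.
  rewrite linear_sum -rP; apply: eq_bigr => j' _.
  by rewrite linearZ /= liftU scale1r.
have [j|j|g gI gP] := @exchange k V J J' v e (fun j j' => A j j' <> 0).
- move=> vj.
  have : fglift (fun j' => B j' j : k^o) (v j) = 0.
    apply: (@lspan_min _ _ _ [set x : V | fglift (fun j' => B j' j : k^o) x = 0] _ _ _ vj)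
      => [|_ [i ij <-]] /=; last first.
      by rewrite Lv; case: eqP => // ji; case: ij.
    by split=> [|a x y]; rewrite /= ?linear0 // linearP /= => -> ->; rewrite scaler0 addr0.
  by rewrite Lv eqxx => /eqP; rewrite oner_eq0.
- rewrite /v; apply: lsubspace_sum; first exact: lspan_lsubspace.
  move=> j' _; have [->|Aj] := eqVneq (A j j') 0; first by rewrite scale0r; exact: lspan0.
  apply: lsubspaceZ; first exact: lspan_lsubspace.
  by apply: lspan_incl; exists j' => //; exact/eqP.
exists g => // j; have := gP j; rewrite /A.
by case: asboolP.
Qed.

End Injection.

(** Injections in both directions that preserve words are combined to a bijection
    that preserves words. *)
Theorem string_sum_unique (J J' : choiceType) (u : J -> qword Q) (u' : J' -> qword Q)
    (f : forall j a, {linear rsp (string_module k (u j)) a -> rsp M a})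
    (f' : forall j a, {linear rsp (string_module k (u' j)) a -> rsp M a}) :
  is_direct_sum (N := fun j => string_module k (u j)) f ->
  is_direct_sum (N := fun j => string_module k (u' j)) f' ->
  (forall j, composable (u j).1 (u j).2) ->
  (forall j, composable (u' j).1 (u' j).2) ->
  exists2 sigma : J -> J', bijective sigma &
    forall j, rep_iso (string_module k (u j)) (string_module k (u' (sigma j))).
Proof.
move=> fsum fsum' cu cu'.
have [g gI gP] := same_word_injection fsum fsum' cu cu'.
have [h hI hP] := same_word_injection fsum' fsum cu' cu.
have [s sI sP] 
  := @cantor_bernstein_rel _ _ g h (fun j j' => same_word (u j) (u' j')) gI hI gP (fun j' => same_word_sym (hP j')).
by exists s => // j; apply: same_word_iso.
Qed.

End Uniqueness.

(** * Decomposition over a quiver directed by time *)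

Theorem timed_decomposition (k : fieldType) (N : Type) (arrow : N -> N -> Prop)
    (M : rep k (rel_quiver arrow)) (time_of : N -> nat) (n : nat)
    (G : forall a b : vtx (rel_quiver arrow), qpath a b -> Prop) :
  timed M time_of -> (forall v, (time_of v < n)%N) ->
  (forall a b (w : qpath a b), G a b w -> arrows w <> [::]) ->
  satisfies M (@ideal k _ G) ->
  exists (J : choiceType) (u : J -> qword (rel_quiver arrow))
    (f : forall j a, {linear rsp (string_module k (u j)) a -> rsp M a}),
    string_decomposition (@ideal k _ G) f.
Proof.
move=> tM time_bound Gw sat; have [F FP] := monomial_bases tM time_bound.
have bF v : lin_basis setT (F v) by have [[]] := FP v.
have mF := monomial_arrow tM (fun v => (FP v).2).
exists (start time_of F), (start_word time_bound (F := F)).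
eexists; split; last exact: (start_sum tM time_bound bF mF).
move=> j; have [q jq _] := start_seqP time_bound j.
apply: (is_string_of_vectors (v := start_vec j) Gw sat).
- exact: track_composable jq.
- by move=> l l'; exact: track_no_backtrack jq.
- by move=> al; exact: (start_arr tM bF mF).
- by move=> a ta; apply: (F_neq0 bF); exact: reach_F (start_vec_reach tM bF mF ta).
Qed.

(** * Transition diagrams *)

Section Positions.
Variables (X : topologicalType) (b : bool) (s t : bterm X).

Definition is_later (x : idx (fine_of b s t) + idx (coarse_of b s t)) : bool :=
  if x is inl _ then ~~ b else b.

Lemma left_pos_later (p : idx s) : is_later (left_pos b t p) = false.
Proof. by rewrite /is_later /left_pos; case: b. Qed.

Lemma right_pos_later (p : idx t) : is_later (right_pos b s p) = true.
Proof. by rewrite /is_later /right_pos; case: b. Qed.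

Lemma left_pos_inj : injective (@left_pos X b s t).
Proof. by rewrite /left_pos; case: b => p q []. Qed.

Lemma right_pos_inj : injective (@right_pos X b s t).
Proof. by rewrite /right_pos; case: b => p q []. Qed.

End Positions.

Section Diagram.
Variables (R : realType) (k : fieldType) (X : topologicalType) (Z : zigzag X).
Variable d : forall l : 'I_(len Z), tstep (Defs.fine Z l) (coarse Z l).
Hypothesis good : forall l, transition_step R k (d l).

(** A function that increases along arrows, so that the digraph is acyclic. *)
Definition node_rank (x : node Z) : nat :=
  match x with
  | TNode l (inr q) => 2%N
  | TNode l (inl p) => match cho (d l) (ind (d l) p) with
      | Defs.Split a _ _ _ _ => if p == a then 1%N else 3%N
      | Single _ b => if b then 1%N else 3%N
      | Birth _ => 3%N
      end
  | ANode l p c => match c with C1 | C3 | C5 => 0%N | C2 | C4 => 5%N end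
  end.

Lemma split_ind l q a r N0 N1 N2 : cho (d l) q = Defs.Split a r N0 N1 N2 ->
  [/\ a <> r, ind (d l) a = q & ind (d l) r = q].
Proof.
move=> e; have [_ /(_ q)] := good l; rewrite /good_choice e.
by move=> [ar fib _ _]; split=> //; apply/fib; [left|right].
Qed.

Lemma edge_rank x y : edge d x y -> (node_rank x < node_rank y)%N.
Proof.
have end_rank (l : 'I_(len Z)) (x0 : idx (Defs.fine Z l) + idx (coarse Z l)) :
    (0 < node_rank (TNode x0))%N.
  by case: x0 => //= p; case: cho => // [a *|_ []] //; case: eqP.
case=> [l q a r N0 N1 N2 e|l q a r N0 N1 N2 e|l q a r N0 N1 N2 e|l p PE e|l p PE e
  |l p|l p|l p|l p|l p|l p]; try exact: end_rank; rewrite //=.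
- by have [_ -> _] := split_ind e; rewrite e eqxx.
- by have [ar _ ->] := split_ind e; rewrite e; case: eqP => // ra; case: ar.
- have [ar -> ->] := split_ind e; rewrite e eqxx; case: eqP => // ra.
  by case: ar.
- by rewrite e.
- by rewrite e.
Qed.

Lemma td_lt_rank x y : td_lt d x y -> (node_rank x < node_rank y)%N.
Proof. by elim=> [u v /edge_rank|u v w _ uv _ vw] //; exact: ltn_trans vw. Qed.

(** The two sides of the step l are at times 7 * l and 7 * l + 1, and each of the
    six arrows of a connecting sequence takes one unit of time.  Modulo 7, the time
    of a node tells what lies on either side of it: a step is to come at 0 and has
    just been made at 1, all other sides are in a connecting sequence. *)
Definition node_time (x : node Z) : nat :=
  match x with
  | TNode l x => (7 * l + @is_later _ (fwd Z l) (term Z l) (term Z l.+1) x)%N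
  | ANode l p c =>
    (7 * l + match c with C1 => 2 | C2 => 3 | C3 => 4 | C4 => 5 | C5 => 6 end)%N
  end.

Lemma node_time_lt x : (node_time x < 7 * (len Z).+1)%N.
Proof.
case: x => [l x|l p c] /=.
  apply: (@leq_trans (7 * l + 2)%N).
    by rewrite ltn_add2l ltnS leq_b1.
  rewrite mulnS addnC; apply: leq_add => //.
  by rewrite leq_mul2l /= ltnW.
have ll : (l < len Z)%N by apply: leq_trans (ltn_ord l) (leq_pred _).
apply: (@leq_trans (7 * l + 7)%N); first by rewrite ltn_add2l; case: c.
by rewrite -mulnSr leq_mul2l /= ltnS ltnW.
Qed.

(** The block over q when there is just one; x is a default value. *)
Definition fibre_node l q (x : node Z) : node Z :=
  if [pick p | ind (d l) p == q] is Some p then TNode (inl p) else x.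

(** The only possible neighbours of a node by an arrow of its step, as source
    and as target. *)
Definition step_src (y : node Z) : node Z :=
  match y with
  | TNode l (inr q) => match cho (d l) q with
      | Defs.Split a _ _ _ _ => TNode (inl a)
      | _ => fibre_node q y
      end
  | TNode l (inl p) => TNode (inr (ind (d l) p))
  | ANode _ _ _ => y
  end.

Definition step_tgt (x : node Z) : node Z :=
  match x with
  | TNode l (inr q) => match cho (d l) q with
      | Defs.Split _ r _ _ _ => TNode (inl r)
      | _ => fibre_node q x
      end
  | TNode l (inl p) => TNode (inr (ind (d l) p))
  | ANode _ _ _ => x
  end.

Definition step_arrow (x y : node Z) : Prop :=
  [/\ x = step_src y, y = step_tgt x &
    exists (l : 'I_(len Z)) (p : idx (Defs.fine Z l)) (q : idx (coarse Z l)),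
      (x = @TNode _ Z l (inl p) /\ y = @TNode _ Z l (inr q)) \/
      (x = @TNode _ Z l (inr q) /\ y = @TNode _ Z l (inl p))].

Definition conn_node (l : 'I_(len Z).-1) (p : idx (term Z l.+1)) (i : nat) : node Z :=
  match i with
  | 0 => left_end p
  | 1 => ANode p C1
  | 2 => ANode p C2
  | 3 => ANode p C3
  | 4 => ANode p C4
  | 5 => ANode p C5
  | _ => right_end p
  end.

Definition conn_arrow (x y : node Z) : Prop :=
  exists (l : 'I_(len Z).-1) (p : idx (term Z l.+1)) i, (i < 6)%N /\
    ((x = conn_node p i /\ y = conn_node p i.+1) \/
     (y = conn_node p i /\ x = conn_node p i.+1)).

Lemma fibre_single l p x PE b : cho (d l) (ind (d l) p) = Single _ PE b ->
  fibre_node (ind (d l) p) x = TNode (inl p).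
Proof.
move=> e; have [_ /(_ (ind (d l) p))] := good l; rewrite /good_choice e.
move=> [[p0 fib _] _ _]; rewrite /fibre_node; case: pickP => [p1 /eqP/fib ->|/(_ p)].
  by have /fib -> : ind (d l) p = ind (d l) p by [].
by rewrite eqxx.
Qed.

(** The arrow from the attractor to the repeller of an AR-split factors through the
    coarse block, and so it is not in the Hasse diagram. *)
Lemma hasse_cases x y : hasse d x y -> step_arrow x y \/ conn_arrow x y.
Proof.
move=> [xy nz]; have {xy}xy : edge d x y.
  by case: xy nz => [? //|v w xv vw []]; exists v.
case: x y / xy nz => [l q a r N0 N1 N2 e|l q a r N0 N1 N2 e|l q a r N0 N1 N2 e
  |l p PE e|l p PE e|l p|l p|l p|l p|l p|l p] nz.
- left; have [_ ia _] := split_ind e; split; rewrite /= ?e ?ia //.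
  by exists l, a, q; left.
- left; have [_ _ ir] := split_ind e; split; rewrite /= ?e ?ir //.
  by exists l, r, q; right.
- case: nz; exists (TNode (inr q)); split; apply: t_step.
    exact: edge_i e.
  exact: edge_j e.
- left; split; rewrite /= ?e ?(fibre_single _ e) //.
  by exists l, p, (ind (d l) p); left.
- left; split; rewrite /= ?e ?(fibre_single _ e) //.
  by exists l, p, (ind (d l) p); right.
- by right; exists l, p, 0%N; split=> //; right.
- by right; exists l, p, 1%N; split=> //; left.
- by right; exists l, p, 2; split=> //; right.
- by right; exists l, p, 3; split=> //; left.
- by right; exists l, p, 4; split=> //; right.
- by right; exists l, p, 5; split=> //; left.
Qed.

Lemma conn_node_time (l : 'I_(len Z).-1) (p : idx (term Z l.+1)) i : (i <= 6)%N ->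
  node_time (conn_node p i) = (7 * l + i.+1)%N.
Proof.
case: i => [|[|[|[|[|[|[|//]]]]]]] _ //=.
- by rewrite right_pos_later.
- by rewrite left_pos_later addn0 mulnSr.
Qed.

Lemma TNode_inj (l : 'I_(len Z)) x x' : @TNode X Z l x = @TNode X Z l x' -> x = x'.
Proof. by case=> e; exact: Eqdep.EqdepTheory.inj_pairT2 e. Qed.

Lemma ANode_inj (l : 'I_(len Z).-1) p p' c c' :
  @ANode X Z l p c = @ANode X Z l p' c' -> p = p'.
Proof. by case=> e _; exact: Eqdep.EqdepTheory.inj_pairT2 e. Qed.

Lemma conn_node_inj (l : 'I_(len Z).-1) (p p' : idx (term Z l.+1)) i :
  conn_node p i = conn_node p' i -> p = p'.
Proof.
case: i => [|[|[|[|[|[|i]]]]]] /= e; try exact: ANode_inj e.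
- by apply: right_pos_inj; exact: TNode_inj e.
- by apply: left_pos_inj; exact: TNode_inj e.
Qed.

Lemma div_mod_uniq m a b r s : (r < m)%N -> (s < m)%N ->
  (m * a + r = m * b + s)%N -> a = b /\ r = s.
Proof.
move=> rm sm e; have m0 : (0 < m)%N by exact: leq_ltn_trans rm.
split.
  by have := congr1 (divn^~ m) e; rewrite /= ![(m * _)%N]mulnC !divnMDl // !divn_small // !addn0.
by have := congr1 (modn^~ m) e; rewrite /= ![(m * _)%N]mulnC !modnMDl !modn_small.
Qed.

(** The time of a node determines the step after which it comes and its position in
    the connecting sequence, and these with the node determine the block. *)
Lemma conn_node_next (l l' : 'I_(len Z).-1) (p : idx (term Z l.+1))
    (p' : idx (term Z l'.+1)) i i' : (i < 6)%N -> (i' < 6)%N ->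
  conn_node p i = conn_node p' i' -> conn_node p i.+1 = conn_node p' i'.+1.
Proof.
move=> i6 i'6 e; have := congr1 node_time e; rewrite !conn_node_time //; try exact: ltnW.
case/div_mod_uniq => // /ord_inj ll' [ii'].
move: ll' p' e; rewrite -ii' => <- p' e.
by rewrite (conn_node_inj e).
Qed.

Lemma conn_node_prev (l l' : 'I_(len Z).-1) (p : idx (term Z l.+1))
    (p' : idx (term Z l'.+1)) i i' : (i < 6)%N -> (i' < 6)%N ->
  conn_node p i.+1 = conn_node p' i'.+1 -> conn_node p i = conn_node p' i'.
Proof.
move=> i6 i'6 e; have := congr1 node_time e; rewrite !conn_node_time // !(addnS _ _.+1) => -[].
case/div_mod_uniq => // /ord_inj ll' [ii'].
move: ll' p' e; rewrite -ii' => <- p' e.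
by rewrite (conn_node_inj e).
Qed.

Definition later_node (x y : node Z) : Prop := exists (l : 'I_(len Z).-1)
  (p : idx (term Z l.+1)) i, [/\ (i < 6)%N, x = conn_node p i & y = conn_node p i.+1].

Lemma later_lt u v : later_node u v -> (node_time u < node_time v)%N.
Proof.
by move=> [l [p [i [i6 -> ->]]]]; rewrite !conn_node_time ?(ltnW i6) // ltn_add2l.
Qed.

Lemma conn_later x y : conn_arrow x y -> later_node x y \/ later_node y x.
Proof.
by move=> [l [p [i [i6 [[-> ->]|[-> ->]]]]]]; [left|right]; exists l, p, i.
Qed.

Lemma later_prev_uniq x x' y : later_node x y -> later_node x' y -> x = x'.
Proof.
move=> [l [p [i [i6 -> ->]]]] [l' [p' [i' [i'6 -> e]]]].
exact: conn_node_prev e.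
Qed.

Lemma later_next_uniq x y y' : later_node x y -> later_node x y' -> y = y'.
Proof.
move=> [l [p [i [i6 -> ->]]]] [l' [p' [i' [i'6 e ->]]]].
exact: conn_node_next e.
Qed.

Lemma later_time x y : later_node x y ->
  (node_time x %% 7 != 0)%N /\ (node_time y %% 7 != 1)%N.
Proof.
move=> [l [p [i [i6 -> ->]]]]; rewrite !conn_node_time ?(ltnW i6) //.
by rewrite ![(7 * _)%N]mulnC !modnMDl; case: i i6 => [|[|[|[|[|[]]]]]].
Qed.

Lemma step_time x y : step_arrow x y \/ step_arrow y x ->
  (node_time x < node_time y)%N -> (node_time x %% 7 = 0)%N /\ (node_time y %% 7 = 1)%N.
Proof.
have main l (p : idx (Defs.fine Z l)) (q : idx (coarse Z l)) (hl : (l < len Z)%N) :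
    let u := @TNode _ Z (Ordinal hl) (inl p) in
    let v := @TNode _ Z (Ordinal hl) (inr q) in
    ((node_time u < node_time v)%N ->
      (node_time u %% 7 = 0)%N /\ (node_time v %% 7 = 1)%N) /\
    ((node_time v < node_time u)%N ->
      (node_time v %% 7 = 0)%N /\ (node_time u %% 7 = 1)%N).
  rewrite /= /is_later !ltn_add2l ![(7 * _)%N]mulnC !modnMDl.
  by case: (fwd Z l).
case=> -[_ _ [[l hl] [p [q [[-> ->]|[-> ->]]]]]]; have [m1 m2] := main l p q hl; auto.
Qed.

Lemma td_lt_irrefl x : ~ td_lt d x x.
Proof. by move=> /td_lt_rank; rewrite ltnn. Qed.

Lemma hasse_asym x y : hasse d x y -> ~ hasse d y x.
Proof. by move=> [xy _] [yx _]; apply: (@td_lt_irrefl x); exact: t_trans xy yx. Qed.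

Lemma hasse_step x y : hasse d x y -> step_arrow x y \/ step_arrow y x ->
  step_arrow x y.
Proof.
move=> /hasse_cases[//|c] st; have [xy|yx] := conn_later c.
  have [_ b] := step_time st (later_lt xy).
  by have [_] := later_time xy; rewrite b.
have [_ b] := step_time ((or_comm _ _).1 st) (later_lt yx).
by have [_] := later_time yx; rewrite b.
Qed.

Definition adjacent x y := hasse d x y \/ hasse d y x.

Lemma adjacent_cases x y : adjacent x y -> (node_time x < node_time y)%N ->
  (step_arrow x y \/ step_arrow y x) \/ later_node x y.
Proof.
move=> adj xy; case: adj => /hasse_cases[s|/conn_later[]];
  try (by left; auto); try (by right; auto).
  by move/later_lt; rewrite ltnNge ltnW.
by move/later_lt; rewrite ltnNge ltnW.
Qed.

(** By the time modulo 7, the arrows on one side of a node are of the same kind. *)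
Lemma side_cases x y z w : adjacent x y -> adjacent z w ->
  (node_time x < node_time y)%N -> (node_time z < node_time w)%N -> x = z \/ y = w ->
  ((step_arrow x y \/ step_arrow y x) /\ (step_arrow z w \/ step_arrow w z)) \/
  (later_node x y /\ later_node z w).
Proof.
move=> xy zw lxy lzw.
have [sxy|cxy] := adjacent_cases xy lxy; have [szw|czw] := adjacent_cases zw lzw.
- by left.
- have [a b] := step_time sxy lxy; have [/eqP a' /eqP b'] := later_time czw.
  by case=> e; rewrite e in a b; [case: a'|case: b'].
- have [a b] := step_time szw lzw; have [/eqP a' /eqP b'] := later_time cxy.
  by case=> e; rewrite -e in a b; [case: a'|case: b'].
- by right.
Qed.

Lemma past_side_uniq x y x' : adjacent x y -> adjacent x' y ->
  (node_time x < node_time y)%N -> (node_time x' < node_time y)%N ->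
  x = x' \/ ((step_arrow x y \/ step_arrow y x) /\ (step_arrow x' y \/ step_arrow y x')).
Proof.
move=> a a' l l'; have [?|[c c']] := side_cases a a' l l' (or_intror erefl).
  by right.
by left; exact: later_prev_uniq c c'.
Qed.

Lemma future_side_uniq x y y' : adjacent x y -> adjacent x y' ->
  (node_time x < node_time y)%N -> (node_time x < node_time y')%N ->
  y = y' \/ ((step_arrow x y \/ step_arrow y x) /\ (step_arrow x y' \/ step_arrow y' x)).
Proof.
move=> a a' l l'; have [?|[c c']] := side_cases a a' l l' (or_introl erefl).
  by right.
by left; exact: later_next_uniq c c'.
Qed.

(** A node has another partner as a source than as a target only when it is the
    coarse block of an AR-split. *)
Lemma step_path x y z : step_arrow x y -> step_arrow y z -> x <> z ->
  exists l q a r N0 N1 N2, [/\ cho (d l) q = Defs.Split a r N0 N1 N2,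
    x = @TNode X Z l (inl a) & z = @TNode X Z l (inl r)].
Proof.
move=> [xy _ [l [p [q [[xE yE]|[xE yE]]]]]] [_ zy _] xz; last first.
  by case: xz; rewrite xy zy yE.
move: xy zy; rewrite yE /=; case e: (cho (d l) q) => [a r N0 N1 N2|PE b|PE].
- by move=> -> ->; exists l, q, a, r, N0, N1, N2.
- by move=> xq zq; case: xz; rewrite xq zq.
- by move=> xq zq; case: xz; rewrite xq zq.
Qed.

Variable n : nat.

Definition td_module : rep k (rel_quiver (hasse d)) :=
  @Rep k (rel_quiver (hasse d)) (fun x => homology R k n (node_pair d x))
    (fun al => homology_map R k n (td_lt_le good (svalP al).1)).

Lemma subquot_class0 (V : lmodType k) (A B : submodClosed V) :
  subquot_class B (0 : submod_sort A) = 0.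
Proof. by apply: (addrI (subquot_class B 0)); rewrite -subquot_classD !addr0. Qed.

(** All maps of the module are induced by inclusions: cycles stay the same. *)
Lemma path_map_class a b (w : @qpath (rel_quiver (hasse d)) a b)
    (c : submod_sort (Defs.cycle (k := k) (n := n) (node_pair d a))) :
  exists2 c' : submod_sort (Defs.cycle (k := k) (n := n) (node_pair d b)),
    val c' = val c &
    path_map td_module w (subquot_class (boundary (node_pair d a)) c) =
    subquot_class (boundary (node_pair d b)) c'.
Proof.
elim: w c => [v|al v w IH] c; first by exists c.
pose le := td_lt_le good (svalP al).1.
have [c' cc' wc'] := IH (submod_incl (cycle_sub le) c).
exists c'; first by rewrite cc'.
rewrite -wc'; exact: (congr1 (path_map td_module w) (subquot_mapE (cycle_sub le) (boundary_sub le) c)).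
Qed.

(** The cycles of the first pair are then chains of the subspace of the second, so
    they are relative boundaries. *)
Lemma path_map_eq0 a b (w : @qpath (rel_quiver (hasse d)) a b) m :
  (node_pair d a).1 `<=` (node_pair d b).2 -> path_map td_module w m = 0.
Proof.
move=> ab; rewrite -[m]subquot_reprK; have [c' cc' ->] := path_map_class w (subquot_repr m).
rewrite -subquot_class0; apply/subquot_classE; rewrite cc' raddf0 addr0.
have /asboolP[ca _] := valP (subquot_repr m).
apply/asboolP; exists 0, (val (subquot_repr m)); split.
- exact: chain_in0.
- exact: chain_in_sub ca.
- by rewrite linear0 add0r.
Qed.

Lemma split_pair l q a r N0 N1 N2 : cho (d l) q = Defs.Split a r N0 N1 N2 ->
  (node_pair d (@TNode X Z l (inl a))).1 `<=` (node_pair d (@TNode X Z l (inl r))).2.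
Proof.
move=> e; have [ar ia ir] := split_ind e.
rewrite /= /fine_pair ia ir e eqxx; case: eqP => [ra|_]; first by case: ar.
exact: subset_refl.
Qed.

(** The two arrows are those of an AR-split, and the first component of the pair of
    the attractor is the second component of the pair of the repeller. *)
Lemma step_zero x y z (h : hasse d x y) (h' : hasse d y z) m :
  step_arrow x y -> step_arrow y z -> amap td_module h' (amap td_module h m) = 0.
Proof.
move=> sxy syz.
have xz : x <> z by move=> e; apply: (hasse_asym h); rewrite e.
have [l [q [a [r [N0 [N1 [N2 [e xE zE]]]]]]]] := step_path sxy syz xz.
pose w : @qpath (rel_quiver (hasse d)) x z :=
  @qcons (rel_quiver (hasse d)) (mkarr h) z
    (@qcons (rel_quiver (hasse d)) (mkarr h') z (@qnil (rel_quiver (hasse d)) z)).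
by apply: (@path_map_eq0 _ _ w m); rewrite xE zE; exact: split_pair e.
Qed.

(** On the side of a step, a node determines its only partner as a source and its
    only partner as a target; on the side of a connecting sequence there is only
    one neighbour, and one arrow to or from it. *)
Lemma td_timed : timed td_module node_time.
Proof.
have adj x y : hasse d x y -> adjacent x y by left.
have adj' x y : hasse d x y -> adjacent y x by right.
have stp x y : hasse d x y -> step_arrow x y \/ step_arrow y x ->
    x = step_src y /\ y = step_tgt x.
  by move=> h /(hasse_step h)[].
have stp' x y : hasse d x y -> step_arrow y x \/ step_arrow x y ->
    x = step_src y /\ y = step_tgt x.
  by move=> h /or_comm /(stp _ _ h).
split.
- move=> x y h e; case: (hasse_cases h) => [[_ _ [l [p [q [[xE yE]|[xE yE]]]]]]|c].
  + by move: e; rewrite xE yE /= /is_later => /addnI; case: (fwd Z l).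
  + by move: e; rewrite xE yE /= /is_later => /addnI; case: (fwd Z l).
  by case: (conn_later c) => /later_lt; rewrite e ltnn.
- move=> x x' y h h' l l'.
  have [//|[s s']] := past_side_uniq (adj _ _ h) (adj _ _ h') l l'.
  exact: etrans (stp _ _ h s).1 (esym (stp _ _ h' s').1).
- move=> x x' y h h' l l'.
  have [//|[s s']] := future_side_uniq (adj' _ _ h) (adj' _ _ h') l l'.
  exact: etrans (stp' _ _ h s).1 (esym (stp' _ _ h' s').1).
- move=> x y y' h h' l l'.
  have [//|[s s']] := past_side_uniq (adj' _ _ h) (adj' _ _ h') l l'.
  exact: etrans (stp' _ _ h s).2 (esym (stp' _ _ h' s').2).
- move=> x y y' h h' l l'.
  have [//|[s s']] := future_side_uniq (adj _ _ h) (adj _ _ h') l l'.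
  exact: etrans (stp _ _ h s).2 (esym (stp _ _ h' s').2).
- move=> x y z h h' m l l'.
  have [xz|[s s']] := past_side_uniq (adj _ _ h) (adj' _ _ h') l l'.
    by case: (hasse_asym h); rewrite xz.
  by apply: step_zero; [exact: hasse_step h s|exact: hasse_step h' ((or_comm _ _).1 s')].
move=> x y z h h' m l l'.
have [xz|[s s']] := future_side_uniq (adj' _ _ h) (adj _ _ h') l l'.
  by case: (hasse_asym h); rewrite xz.
by apply: step_zero; [exact: hasse_step h ((or_comm _ _).1 s)|exact: hasse_step h' s'].
Qed.

End Diagram.

Lemma arrows_ends (Q : quiver) (a b : vtx Q) (w : qpath a b) :
  (forall al s, arrows w = al :: s -> a = src al) /\
  (forall s al, arrows w = rcons s al -> b = tgt al).
Proof.
elim: w => [v|al v w [_ IH]] /=; first by split=> [//|[]].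
have nil_ends c e (x : qpath c e) : arrows x = [::] -> e = c by case: x.
split=> [be s [ale _]|s be]; first by rewrite ale.
case: s => [|be' s] /= [ale ws]; last exact: IH ws.
by rewrite -ale; exact: nil_ends ws.
Qed.

Theorem theorem7p4 (R : realType) (k : fieldType) (X : topologicalType)
    (finX : finite_set [set: X]) (T0X : kolmogorov_space X)
    (Z : zigzag X) (filtZ : zigzag_filtration R k Z)
    (D : transition_diagram R k Z) (n : nat) :
  let M := conley_morse_module D n in
  [/\ satisfies M (@ar_ideal R k X Z D),
      exists (J : choiceType) (u : J -> qword (td_quiver D))
        (f : forall j a, {linear rsp (string_module k (u j)) a -> rsp M a}),
        string_decomposition (@ar_ideal R k X Z D) f &
      forall (J J' : choiceType)
        (u : J -> qword (td_quiver D)) (u' : J' -> qword (td_quiver D))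
        (f : forall j a, {linear rsp (string_module k (u j)) a -> rsp M a})
        (f' : forall j a, {linear rsp (string_module k (u' j)) a -> rsp M a}),
        string_decomposition (@ar_ideal R k X Z D) f ->
        string_decomposition (@ar_ideal R k X Z D) f' ->
        exists2 sigma : J -> J', bijective sigma &
          forall j, rep_iso (string_module k (u j))
                            (string_module k (u' (sigma j)))].
Proof.
have sat : satisfies (conley_morse_module D n) (@ar_ideal R k X Z D).
  apply: satisfies_ideal => a b w [l [q [a0 [r [N0 [N1 [N2 [al [be [e ale bee wE]]]]]]]]]] m.
  have ab : (node_pair (@td_step _ _ _ _ D) a).1 `<=` (node_pair (@td_step _ _ _ _ D) b).2.
    have [/(_ _ _ wE) aE /(_ [:: al] be wE) bE] := arrows_ends w.
    have sp := split_pair (@td_good _ _ _ _ D) e.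
    by rewrite aE bE /= ale bee; exact: sp.
  exact: (@path_map_eq0 _ _ _ _ _ (@td_good _ _ _ _ D) n a b w m ab).
move=> M; split=> //.
  apply: (timed_decomposition (td_timed (@td_good _ _ _ _ D) n) (@node_time_lt _ _)) => //.
  move=> a b w [l [q [a0 [r [N0 [N1 [N2 [al [be [_ _ _ ->]]]]]]]]]]; by [].
move=> J J' u u' f f' [su sum] [su' sum'].
apply: string_sum_unique sum sum' _ _ => j; first by case: (su j).
by case: (su' j).
Qed.
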